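(* Let $d\ge2$. For every $\ell\in(0,1]$ there is a constant $\eta_0=\eta_0(d,\ell)\in(0,\tfrac14]$ such that the following holds. Let $L\ge1$ and let $u\in C(B_1)$ be nonnegative, harmonic in its positivity set, with $\|\nabla u\|_{L^\infty(B_1)}\le L$ and $0\in\partial\{u>0\}$. (i) For every $\delta>0$ and $\ell\in(0,1]$ there is $r_0=r_0(d,\delta,L,\ell)>0$ with the following property. If $$(x_d)_+\le u\le(x_d+\eta_0(d,\ell))_+\ \text{ in }B_1$$ and $\ell\le|\nabla u|\le1$ on $\partial\{u>0\}\cap B_1\setminus\overline{B_{r_0}}$, then $u\le(x_d+\delta)_+$ in $B_{1/2}$. (ii) For every $\delta>0$ and $\ell\in(0,1)$ there is $r_0=r_0(d,\delta,L,\ell)>0$ with the following property. If $$u\le(x_d)_+\ \text{ in }B_1\quad\text{and}\quad|\nabla u|\ge\ell\ \text{ on }\partial\{u>0\}\cap B_1,$$ and $|\nabla u|\ge1$ on $\partial\{u>0\}\cap B_1\setminus\overline{B_{r_0}}$, then $u\ge(x_d-\delta)_+$ in $B_{1/2}$. (The constants $r_0$ do not depend on $u$.)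
   Context: $B_r$ is the open ball of radius $r$ centered at $0$ in $\mathbb{R}^d$. The slope conditions are understood in the viscosity sense: for an open set $V$ and a constant $a>0$, - ''$|\nabla u|\le a$ on $\partial\{u>0\}\cap V$'' means $u$ is a supersolution in $V$: whenever $\varphi\in C^\infty(V)$ touches $u$ from below at $x\in V$ (i.e. $u-\varphi$ has a local minimum zero at $x$), either $\Delta\varphi(x)\le0$, or $\varphi(x)=0$ and $|\nabla\varphi(x)|\le a$; - ''$|\nabla u|\ge a$ on $\partial\{u>0\}\cap V$'' means $u$ is a subsolution in $V$: whenever $\varphi\in C^\infty(V)$ touches $u$ from above in $\overline{\{u>0\}}\cap V$ at $x$ (i.e. $x\in\overline{\{u>0\}}$ and $u-\varphi$ restricted to $\overline{\{u>0\}}\cap V$ has a local maximum zero at $x$), either $\Delta\varphi(x)\ge0$, or $\varphi(x)=0$ and $|\nabla\varphi(x)|\ge a$. *)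

(* Defs.v *)
From mathcomp Require Import all_boot all_order all_algebra.
From mathcomp Require Import all_classical all_reals all_analysis.
Set Implicit Arguments.
Unset Strict Implicit.
Unset Printing Implicit Defensive.
Import Order.TTheory GRing.Theory Num.Theory.
Import numFieldNormedType.Exports.
Local Open Scope classical_set_scope.
Local Open Scope ring_scope.

(* R^d is 'rV[R]_d.  Its library norm is the sup norm: the topology is the
   right one, but Euclidean lengths have to be defined separately.
   Functions on an open set V are total functions 'rV[R]_d -> R; every
   definition below only depends on their restriction to V. *)

Section Euclidean.
Context {R : realType} {d : nat}.
Implicit Types (x : 'rV[R]_d) (f u : 'rV[R]_d -> R) (A V : set 'rV[R]_d).

Definition enorm x : R := Num.sqrt (\sum_(i < d) x 0 i ^+ 2).

Definition eball (r : R) : set 'rV[R]_d := [set x | enorm x < r].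

Definition frontier A : set 'rV[R]_d := closure A `\` A°.

Definition partial (i : 'I_d) f : 'rV[R]_d -> R :=
  fun x => 'D_(delta_mx 0 i) f x.

Definition grad f x : 'rV[R]_d := \row_i partial i f x.

Definition laplacian f x : R := \sum_(i < d) partial i (partial i f) x.

(* C^k(V) for V open: all partial derivatives of order <= k exist and are
   continuous on V *)
Fixpoint Ck_on (k : nat) V f : Prop :=
  {within V, continuous f} /\
  if k is k'.+1 then
    forall i : 'I_d, (forall x, V x -> derivable f x (delta_mx 0 i)) /\
                     Ck_on k' V (partial i f)
  else True.

Definition smooth_on V f : Prop := forall k, Ck_on k V f.

Definition harmonic_on V f : Prop :=
  Ck_on 2 V f /\ forall x, V x -> laplacian f x = 0.

(* Lebesgue-null subsets of R^d: countable covers by closed boxes of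
   arbitrarily small total volume (the library has no Lebesgue measure on
   'rV[R]_d) *)
Definition box (a b : 'rV[R]_d) : set 'rV[R]_d :=
  [set x | forall i, a 0 i <= x 0 i <= b 0 i].

Definition null_set A : Prop :=
  forall e : R, 0 < e ->
  exists a b : nat -> 'rV[R]_d,
    [/\ forall k i, a k 0 i <= b k 0 i,
        A `<=` \bigcup_k box (a k) (b k) &
        (\sum_(0 <= k <oo) (\prod_(i < d) (b k 0 i - a k 0 i))%:E < e%:E)%E].

(* ||grad f||_{L^oo(V)} <= L: functions with locally bounded weak gradient are
   the locally Lipschitz ones, and their weak gradient is the classical one,
   which exists almost everywhere (Rademacher) *)
Definition locally_lipschitz_on V f : Prop :=
  forall x, V x -> exists K : R,
    \forall y \near x & z \near x, `|f y - f z| <= K * enorm (y - z).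

Definition grad_Linfty_le (L : R) V f : Prop :=
  locally_lipschitz_on V f /\
  null_set (V `&` ~` [set x | differentiable f x /\ enorm (grad f x) <= L]).

Definition posset V u : set 'rV[R]_d := [set x | V x /\ 0 < u x].

Definition touches_below V (phi u : 'rV[R]_d -> R) x : Prop :=
  u x - phi x = 0 /\
  \forall y \near x, V y -> u x - phi x <= u y - phi y.

Definition touches_above V (phi u : 'rV[R]_d -> R) x : Prop :=
  [/\ closure (posset V u) x, u x - phi x = 0 &
      \forall y \near x, closure (posset V u) y -> V y ->
        u y - phi y <= u x - phi x].

(* "|grad u| <= a on (frontier of {u > 0}) /\ V": u is a supersolution in V *)
Definition slope_le (a : R) V u : Prop :=
  forall (phi : 'rV[R]_d -> R) x, smooth_on V phi -> V x ->
    touches_below V phi u x ->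
    laplacian phi x <= 0 \/ (phi x = 0 /\ enorm (grad phi x) <= a).

(* "|grad u| >= a on (frontier of {u > 0}) /\ V": u is a subsolution in V *)
Definition slope_ge (a : R) V u : Prop :=
  forall (phi : 'rV[R]_d -> R) x, smooth_on V phi -> V x ->
    touches_above V phi u x ->
    0 <= laplacian phi x \/ (phi x = 0 /\ a <= enorm (grad phi x)).

Definition admissible (L : R) u : Prop :=
  let B1 := eball 1 in
  [/\ {within B1, continuous u},
      forall x, B1 x -> 0 <= u x,
      harmonic_on (posset B1 u) u,
      grad_Linfty_le L B1 u &
      frontier (posset B1 u) 0].

End Euclidean.

Definition pospart {R : realType} (t : R) : R := Num.max t 0.

Definition xlast {R : realType} {m : nat} (x : 'rV[R]_m.+1) : R := x 0 ord_max.

(* Main.v *)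
(** Both parts follow from an improvement of slope at flat free boundary points.

    Write x = (x', x_d), B_r^+ = B_r /\ {x_d >= 0}.  In (i), u - x_d is nonnegative
    and harmonic in the upper half ball; if u(z) > z_d + eps somewhere, the Lipschitz
    bound and an explicit Hopf barrier give u >= (1 + c) x_d on a smaller half ball.
    Whenever u >= a x_d on B_r^+ with a > 1, comparison with a quadratic of slope > 1
    near the point (r/2) e_1 of {x_d = 0}, which stays away from the exceptional ball
    B_{r0}, makes u - a x_d positive there by an amount comparable to r, and the Hopf
    barrier upgrades this to u >= (a + gamma) x_d on B_{r/2}^+ with gamma independent
    of r.  After finitely many scales a > L, contradicting |grad u| <= L and u(0) = 0.
    So u <= x_d + eps on {x_d >= 0}, and as eta0 is small compared with l a quadratic
    barrier of slope < l shows that u vanishes below {x_d = - delta}.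

    In (ii) the same iteration, with a x_d - u in place of u - a x_d, decreases a until
    a <= l/2; the nondegeneracy |grad u| >= l then forces 0 outside the closure of
    {u > 0}, a contradiction. *)

Require Import Defs.
From mathcomp Require Import all_boot all_order all_algebra.
From mathcomp Require Import all_classical all_reals all_analysis.
From mathcomp Require Import measurable_realfun ring lra.
Set Implicit Arguments.
Unset Strict Implicit.
Import Order.TTheory GRing.Theory Num.Theory.
Import numFieldNormedType.Exports.
Local Open Scope classical_set_scope.
Local Open Scope ring_scope.

(** * Gradient bound and Lipschitz estimate *)

(** The slope conditions with constant 1 say nothing in B_{r0}, which contains the centre of every
    half ball. Hence the barriers are run around a tangential point at distance r/2 from 0, and what
    makes this work is scale invariance: the gain [gam] found there is the same at every radius r.
    The number N of halvings up to the contradiction is thus fixed before u is chosen, and the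
    iteration allows r0 to be an eighth of the last radius.

    Two kinds of barriers are kept apart. The slope conditions are tested only with quadratics,
    whose smoothness, gradient and Laplacian are explicit. The Gaussian Hopf barrier is compared
    only with superharmonic functions, for which a second derivative test along coordinate lines
    suffices.

    The gradient bound is given only almost everywhere, and u may fail to be differentiable on its
    free boundary. Continuity of the derivatives in {u > 0} makes the bound pointwise there, and a
    one-dimensional argument at points with u > 0 then gives the Lipschitz estimate. *)

Lemma section_series_lt (R : realType) (c a b : nat -> R) (e p t : R) :
  (forall k, 0 <= c k) -> (forall k, a k <= b k) -> 0 < t ->
  (\sum_(0 <= k <oo) (c k * (b k - a k))%:E < e%:E)%E ->
  exists s, p <= s <= p + t /\
    (\sum_(0 <= k <oo) (c k * (a k <= s <= b k)%R%:R)%:E < (e / t)%:E)%E.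
Proof.
(* Averaging over [p, p + t]: if the series were at least [e / t] at every s, its integral would be
   at least e, whereas termwise integration bounds it by the sum of the [c k * (b k - a k)]. *)
move=> c0 ab t0 sume; apply: contrapT => H.
have {}H s : p <= s <= p + t ->
    ((e / t)%:E <= \sum_(0 <= k <oo) (c k * (a k <= s <= b k)%R%:R)%:E)%E.
  by move=> sI; rewrite leNgt; apply/negP => Hs; apply: H; exists s.
pose mu := @lebesgue_measure R.
pose D : set R := `[p, p + t]%classic.
have mD : measurable D by exact: measurable_itv.
pose f k (s : R) : \bar R := ((c k)%:E * (\1_(`[a k, b k]%classic) s)%:E)%E.
have fE k s : f k s = (c k * (a k <= s <= b k)%R%:R)%:E.
  rewrite /f -EFinM indicE; congr (_ * _)%:E.
  by rewrite mem_setE in_itv.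
have mf k : measurable_fun D (f k).
  apply: measurable_funeM; apply/measurable_EFinP.
  by apply: measurable_indic; exact: measurable_itv.
have f0 k s : D s -> (0 <= f k s)%E.
  by move=> _; rewrite fE lee_fin mulr_ge0// ler0n.
have e0 : 0 < e.
  rewrite -lte_fin; apply: le_lt_trans sume; apply: nneseries_ge0 => k _ _.
  by rewrite lee_fin mulr_ge0// subr_ge0.
have h1 : (e%:E <= \int[mu]_(s in D) (\sum_(0 <= k <oo) f k s))%E.
  apply: (@le_trans _ _ (\int[mu]_(s in D) (cst (e / t)%:E s))%E).
    rewrite integral_cst//= /D lebesgue_measure_itv/= lte_fin ltrDl t0 -EFinB -EFinM.
    by rewrite addrAC subrr add0r divfK// gt_eqF.
  apply: ge0_le_integral => //.
  - by move=> s Ds; rewrite lee_fin; apply: divr_ge0; exact: ltW.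
  - apply: (@ge0_emeasurable_sum _ _ _ _ _ xpredT) => [k s Ds _|k _].
      exact: f0.
    exact: mf.
  - move=> s /=; rewrite /D/= in_itv/= => /H Hs; apply: le_trans Hs _.
    by apply: lee_nneseries => [k _ _|k _]; rewrite ?fE// lee_fin mulr_ge0// ler0n.
have h2 : (\int[mu]_(s in D) (\sum_(0 <= k <oo) f k s) < e%:E)%E.
  rewrite integral_nneseries//.
  apply: le_lt_trans sume; apply: lee_nneseries => [k _ _|k _].
    by apply: integral_ge0 => s; exact: f0.
  rewrite ge0_integralZl//; last 2 first.
  - by apply/measurable_EFinP; apply: measurable_indic; exact: measurable_itv.
  - by rewrite lee_fin.
  rewrite integral_indic//.
  rewrite EFinM lee_wpmul2l ?lee_fin//.
  apply: (@le_trans _ _ (mu `[a k, b k]%classic)).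
    by apply: le_measure; rewrite ?inE//=; apply: measurableI.
  rewrite /mu lebesgue_measure_itv/= lte_fin -EFinB; case: ifP => //.
  by rewrite lee_fin subr_ge0.
by have := le_lt_trans h1 h2; rewrite ltxx.
Qed.
(* Fubini by hand: the coordinates of x are chosen one at a time, each choice
   turning the total volume of the covering boxes into that of their sections;
   once all are chosen the total is < 1, so no box contains x. *)
Lemma null_set_box_escape (R : realType) (d : nat) (A : set 'rV[R]_d) (p : 'rV[R]_d) (t : R) :
  0 < t -> Defs.null_set A ->
  exists x : 'rV[R]_d, (forall i, p 0 i <= x 0 i <= p 0 i + t) /\ ~ A x.
Proof.
move=> t0 nA; have [a [b [ab Acov sumab]]] := nA (t ^+ d) (exprn_gt0 d t0).
pose F (j : nat) (v : 'rV[R]_d) k (i : 'I_d) : R :=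
  if (i < j)%N then (a k 0 i <= v 0 i <= b k 0 i)%R%:R else b k 0 i - a k 0 i.
have F0 j v k i : 0 <= F j v k i.
  by rewrite /F; case: ifP => _; rewrite ?ler0n// subr_ge0.
have step j : (j <= d)%N -> exists v : 'rV[R]_d,
    (forall i : 'I_d, (i < j)%N -> p 0 i <= v 0 i <= p 0 i + t) /\
    (\sum_(0 <= k <oo) (\prod_(i < d) F j v k i)%:E < (t ^+ d / t ^+ j)%:E)%E.
  elim: j => [_|j IH jd].
    by exists 0; split => //; rewrite expr0 divr1.
  have [v [vp sv]] := IH (ltnW jd).
  pose i0 := Ordinal jd.
  pose c k := \prod_(i < d | i != i0) F j v k i.
  have sv' : (\sum_(0 <= k <oo) (c k * (b k 0 i0 - a k 0 i0))%:E < (t ^+ d / t ^+ j)%:E)%E.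
    move: sv; congr (_ < _)%E; apply: eq_eseriesr => k _; congr EFin.
    by rewrite (bigD1 i0)//= {1}/F/= ltnn mulrC.
  have c0 k : 0 <= c k by apply: prodr_ge0.
  have [s [ps ss]] := @section_series_lt R c _ _ _ (p 0 i0) t c0 (fun k => ab k i0) t0 sv'.
  pose w : 'rV[R]_d := \row_i (if i == i0 then s else v 0 i).
  exists w; split => [i|].
    rewrite ltnS leq_eqVlt mxE; case: (eqVneq i i0) => [-> _ //|ii0 /orP[/eqP ij|]]; last exact: vp.
    by case/eqP: ii0; apply: val_inj.
  rewrite exprSr invfM mulrA; move: ss; congr (_ < _)%E.
  apply: eq_eseriesr => k _; congr EFin.
  rewrite (bigD1 i0)//= mulrC; congr (_ * _); first by rewrite /F/= ltnSn mxE eqxx.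
  apply: eq_bigr => i ii0; rewrite /F mxE (negbTE ii0) (_ : (i < j.+1)%N = (i < j)%N)//.
  by rewrite ltnS leq_eqVlt -[j]/(i0 : nat) (inj_eq val_inj) (negbTE ii0).
have [v [vp]] := step d (leqnn d).
rewrite divff ?gt_eqF ?exprn_gt0// => sv; exists v; split => [i|/Acov [k _ vk]].
  exact: vp.
have : (1%:E <= \sum_(0 <= k <oo) (\prod_(i < d) F d v k i)%:E)%E.
  apply: (@le_trans _ _ (\sum_(0 <= k < k.+1) (\prod_(i < d) F d v k i)%:E)%E); last first.
    by apply: nneseries_lim_ge => j _ _; rewrite lee_fin prodr_ge0.
  rewrite big_nat_recr//= (_ : \prod_(i < d) F d v k i = 1); last first.
    by apply: big1 => i _; rewrite /F ltn_ord vk.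
  by rewrite leeDr// sume_ge0// => j _; rewrite lee_fin prodr_ge0.
by rewrite leNgt sv.
Qed.

Lemma is_derive_line (R : realType) (V : normedModType R) (f : V -> R) (x v : V) (s : R) :
  derivable f (x + s *: v) v ->
  is_derive s (1 : R) (fun t : R => f (x + t *: v)) ('D_v f (x + s *: v)).
Proof.
move=> df.
have E : (fun h : R => h^-1 *: (f (x + (h *: (1 : R) + s) *: v) - f (x + s *: v))) =
         (fun h : R => h^-1 *: (f (h *: v + (x + s *: v)) - f (x + s *: v))).
  apply/funext => h; congr (_ *: (f _ - _)).
  by rewrite scalerDl addrCA; congr (_ *: _ + _); exact: mulr1.
by split; [rewrite /derivable /= E|rewrite /derive /= E].
Qed.

(** The factor [h] treats both sides of [c] at once: values drop to the right and rise to the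
    left. *)
Lemma derive_lt0_near (R : realType) (f : R -> R) (c d : R) :
  is_derive c (1 : R) f d -> d < 0 ->
  \forall h \near (0 : R), h != 0 -> (f (h + c) - f c) * h < 0.
Proof.
move=> [dfc dE] d0.
have lim : h^-1 *: (f (h *: (1 : R) + c) - f c) @[h --> 0^'] --> d.
  by rewrite -dE; exact: dfc.
have := lim (fun y => y < 0) (lt_nbhsl d0).
rewrite /= => /nbhs_ballP[e /= e0 He].
near=> h => h0.
have /= := He h; rewrite /ball/= sub0r normrN => /(_ _ h0).
have -> : h *: (1 : R) + c = h + c by congr (_ + _); exact: mulr1.
have -> : h^-1 *: (f (h + c) - f c) = ((f (h + c) - f c) * h) / h ^+ 2.
  by rewrite -[LHS]/(h^-1 * (f (h + c) - f c)); field.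
rewrite ltr_pdivrMr ?exprn_even_gt0// mul0r; apply.
near: h.
by exists e => //= h /=; rewrite sub0r normrN.
Unshelve. all: by end_near. Qed.

(* A maximum of f s - (L + eta) s at s > 0 has f s > f 0 >= 0, so f is
   differentiable there: the zero set of f never has to be examined. *)
Lemma lipschitz_of_derive_where_pos (R : realType) (f : R -> R) (L t : R) :
  0 <= t -> 0 <= L -> {within `[0, t]%classic, continuous f} ->
  (forall s : R, 0 <= s <= t -> 0 <= f s) ->
  (forall s : R, 0 <= s <= t -> 0 < f s -> exists2 d : R, is_derive s (1 : R) f d & `|d| <= L) ->
  f t <= f 0 + L * t.
Proof.
move=> t0 L0 cf f0 df; rewrite leNgt; apply/negP => ft.
have tp : 0 < t.
  rewrite lt_neqAle t0 andbT; apply/negP => /eqP tE; move: ft.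
  by rewrite -tE mulr0 addr0 ltxx.
pose eta := (f t - (f 0 + L * t)) / (t *+ 2).
have eta0 : 0 < eta by rewrite divr_gt0 ?subr_gt0 ?pmulrn_lgt0.
pose h s := f s - (L + eta) * s.
have ch : {within `[0, t]%classic, continuous h}.
  move=> s; apply: continuousB; first exact: cf.
  apply: continuous_subspaceT => {}s.
  by apply: mulrl_continuous.
have [c cI cmax] := EVT_max t0 ch.
have hc : f 0 < h c.
  apply: lt_le_trans (cmax t _); last by rewrite in_itv/= t0 lexx.
  rewrite /h /eta mulrDl opprD addrA ltrBrDl.
  have -> : (f t - (f 0 + L * t)) / (t *+ 2) * t = (f t - (f 0 + L * t)) / 2.
    by field; rewrite gt_eqF.
  lra.
have /andP[c0 ct] : 0 <= c <= t by move: cI; rewrite in_itv.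
have cp : 0 < c.
  rewrite lt_neqAle c0 andbT; apply/negP => /eqP cE; move: hc.
  by rewrite -cE /h mulr0 subr0 ltxx.
have fc : 0 < f c.
  have : 0 <= (L + eta) * c by rewrite mulr_ge0 ?addr_ge0// ltW.
  by move: hc (f0 0); rewrite /h lexx t0 => + /(_ isT); lra.
have [d dfc dL] := df c cI fc.
have dh : is_derive c (1 : R) h (d - (L + eta)).
  have -> : h = f - (L + eta) \*: id by [].
  by apply: is_deriveB; rewrite -[X in is_derive _ _ _ X]mulr1; exact: is_deriveZ.
have dneg : d - (L + eta) < 0.
  by have := ler_norm d; lra.
have /nbhs_ballP[e /= e0 He] := derive_lt0_near dh dneg.
pose k := - (Num.min (e / 2) c).
have mk : 0 < Num.min (e / 2) c by rewrite lt_min cp divr_gt0.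
have kneg : k < 0 by rewrite oppr_lt0.
have := He k; rewrite /ball/= sub0r normrN ltr0_norm// opprK gt_min.
rewrite {1}ltr_pdivrMr// ltr_pMr// ltr1n => /(_ isT (ltr0_neq0 kneg)).
rewrite nmulr_llt0// subr_gt0 ltNge cmax//.
have mc : Num.min (e / 2) c <= c by rewrite ge_min lexx orbT.
by rewrite in_itv/= /k; apply/andP; split; lra.
Qed.

(** The missing inequality is the one-sided estimate applied to the reversed function
    [f (t - s)]. *)
Lemma dist_le_of_derive_where_pos (R : realType) (f : R -> R) (L t : R) :
  0 <= t -> 0 <= L -> (forall s : R, 0 <= s <= t -> {for s, continuous f}) ->
  (forall s : R, 0 <= s <= t -> 0 <= f s) ->
  (forall s : R, 0 <= s <= t -> 0 < f s ->
    exists2 d : R, is_derive s (1 : R) f d & `|d| <= L) ->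
  `|f t - f 0| <= L * t.
Proof.
move=> t0 L0 cf f0 df.
have rI (s : R) : 0 <= s <= t -> 0 <= t - s <= t by lra.
have up : f t <= f 0 + L * t.
  apply: lipschitz_of_derive_where_pos => //.
  by apply: continuous_in_subspaceT => s; rewrite mem_setE in_itv; exact: cf.
have := @lipschitz_of_derive_where_pos R (fun s => f (t - s)) L t t0 L0.
rewrite subrr subr0 => H.
suff : f 0 <= f t + L * t by rewrite ler_norml; lra.
apply: H.
- apply: continuous_in_subspaceT => s; rewrite mem_setE in_itv => /rI/cf cs.
  by apply: continuous_comp => //; apply: cvgB; [exact: cvg_cst|exact: cvg_id].
- by move=> s sI; apply: f0; exact: rI.
- move=> s sI fs; have [d dd dL] := df _ (rI _ sI) fs.
  exists (- d); last by rewrite normrN.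
  have h : is_derive s (1 : R) (fun s : R => t - s) (- 1).
    by rewrite -[X in is_derive _ _ _ X]add0r; exact: is_deriveB.
  have := @is_derive1_comp R f (fun s : R => t - s) s d (- 1) dd h.
  by rewrite mulrN1.
Qed.

(** Working with the squared length keeps all comparisons polynomial. *)
Definition sqn (R : realType) (d : nat) (x : 'rV[R]_d) : R := \sum_(i < d) x 0 i ^+ 2.

Section sqn.
Context {R : realType} {d : nat}.
Implicit Types x y : 'rV[R]_d.

Lemma sqn_ge0 x : 0 <= sqn x.
Proof. by apply: sumr_ge0 => i _; exact: sqr_ge0. Qed.

Lemma coord_sqr_le_sqn x i : x 0 i ^+ 2 <= sqn x.
Proof. by rewrite /sqn (bigD1 i)//= lerDl sumr_ge0// => j _; exact: sqr_ge0. Qed.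

Lemma sqr_enorm x : enorm x ^+ 2 = sqn x.
Proof. by rewrite sqr_sqrtr// sqn_ge0. Qed.

Lemma enorm_ge0 x : 0 <= enorm x. Proof. exact: sqrtr_ge0. Qed.

Lemma enorm_lt x (r : R) : 0 <= r -> (enorm x < r) = (sqn x < r ^+ 2).
Proof. by move=> r0; rewrite -sqr_enorm ltr_pXn2r// nnegrE enorm_ge0. Qed.

Lemma enorm_le x (r : R) : 0 <= r -> (enorm x <= r) = (sqn x <= r ^+ 2).
Proof. by move=> r0; rewrite -sqr_enorm ler_pXn2r// nnegrE enorm_ge0. Qed.

Lemma coord_norm_le_enorm x i : `|x 0 i| <= enorm x.
Proof.
rewrite -(ler_pXn2r (ltn0Sn 1)) ?nnegrE ?enorm_ge0// real_normK ?num_real// sqr_enorm.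
exact: coord_sqr_le_sqn.
Qed.

Lemma sqn_continuous : continuous (@sqn R d).
Proof.
have -> : @sqn R d = \sum_(i < d) (fun x : 'rV[R]_d => x 0 i ^+ 2).
  by apply/funext => x; rewrite fct_sumE.
apply: (big_ind (fun f : 'rV[R]_d -> R => continuous f)).
- exact: cst_continuous.
- by move=> f g cf cg x; apply: continuousD; [exact: cf|exact: cg].
- by move=> i _ x; apply: continuousM; exact: coord_continuous.
Qed.

Lemma eball_open (r : R) : open (eball r : set 'rV[R]_d).
Proof.
have [r0|r0] := lerP 0 r.
  have -> : eball r = (@sqn R d) @^-1` [set y | y < r ^+ 2].
    by apply/seteqP; split => x; rewrite /eball/= enorm_lt.
  by apply: open_comp; [move=> x _; exact: sqn_continuous|exact: open_lt].
rewrite (_ : eball r = set0); first exact: open0.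
apply/seteqP; split => x //=; rewrite /eball/= => xr.
by have := le_lt_trans (enorm_ge0 x) (lt_trans xr r0); rewrite ltxx.
Qed.

Lemma sqn_le_closed (r : R) : closed [set x : 'rV[R]_d | sqn x <= r].
Proof.
apply: (@closed_comp _ _ (@sqn R d) [set y | y <= r]); last exact: closed_le.
by move=> x _; exact: sqn_continuous.
Qed.

Lemma closure_eball (r : R) x : 0 <= r -> closure (eball r) x -> sqn x <= r ^+ 2.
Proof.
move=> r0; rewrite closureE => H.
by apply: (H [set x | sqn x <= r ^+ 2]); split; [exact: sqn_le_closed|
  move=> y; rewrite /eball/= enorm_lt//; exact: ltW].
Qed.

End sqn.

(** * Pointwise consequences of admissibility *)

Section admissible.
Context {R : realType} {d : nat}.
Implicit Types x y z : 'rV[R]_d.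
Variables (L : R) (u : 'rV[R]_d -> R).
Hypotheses (L0 : 0 <= L) (uL : admissible L u).

Lemma admissible_continuous x : eball 1 x -> {for x, continuous u}.
Proof.
case: uL => cu _ _ _ _ Bx.
by move: cu; rewrite (continuous_open_subspace _ (@eball_open R d 1)); apply; rewrite inE.
Qed.

Lemma admissible_ge0 x : eball 1 x -> 0 <= u x.
Proof. by case: uL => _ u0 _ _ _; exact: u0. Qed.

Lemma posset_open : open (posset (eball 1) u).
Proof.
rewrite openE => x [Bx ux].
have h1 : nbhs x (eball 1) by apply: open_nbhs_nbhs; split => //; exact: eball_open.
have h2 : nbhs x [set y | 0 < u y].
  exact: (admissible_continuous Bx (lt_nbhsr ux)).
exact: filterI h1 h2.
Qed.

Lemma admissible_at0 : u 0 = 0.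
Proof.
case: (uL) => _ _ _ _ [_ /= not0].
have B0 : eball (1 : R) (0 : 'rV[R]_d).
  rewrite /eball/= enorm_lt// /sqn big1 ?expr1n// => i _.
  by rewrite mxE expr0n.
apply/eqP; rewrite eq_le admissible_ge0// andbT leNgt; apply/negP => u0.
by apply: not0; apply: posset_open.
Qed.

Lemma admissible_derivable x i : posset (eball 1) u x -> derivable u x (delta_mx 0 i).
Proof. by case: uL => _ _ [[_ /(_ i)[+ _]] _ _ _] => h; exact: h. Qed.

Lemma admissible_derivable2 x i : posset (eball 1) u x ->
  derivable (partial i u) x (delta_mx 0 i).
Proof. by case: uL => _ _ [[_ /(_ i)[_ [_ /(_ i)[+ _]]]] _ _ _] => h; exact: h. Qed.

Lemma admissible_laplacian x : posset (eball 1) u x -> laplacian u x = 0.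
Proof. by case: uL => _ _ [_ + _ _] => h; exact: h. Qed.

Lemma partial_continuous x i : posset (eball 1) u x -> {for x, continuous (partial i u)}.
Proof.
case: uL => _ _ [[_ /(_ i)[_ [cp _]]] _ _ _] Px.
by move: cp; rewrite (continuous_open_subspace _ posset_open); apply; rewrite inE.
Qed.

(** A violation at x persists, by continuity of the derivative, on a small cube around x; such a
    cube is not contained in the exceptional null set, by [null_set_box_escape]. *)
Lemma partial_norm_le x i : posset (eball 1) u x -> `|partial i u x| <= L.
Proof.
move=> Px; rewrite leNgt; apply/negP => Lx.
have h1 : nbhs x (posset (eball 1) u) by apply: open_nbhs_nbhs; split => //; exact: posset_open.
have h2 : nbhs x [set y | L < `|partial i u y|].
  have /= h := @continuous_comp _ _ _ (partial i u) (@Num.norm _ R) x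
    (partial_continuous Px) (@norm_continuous _ _ _).
  exact: (h _ (lt_nbhsr Lx)).
have [e /= e0 He] := (@nbhs_ballP R _ x _).1 (filterI h1 h2).
case: uL => _ _ _ [_ nB] _.
(* The cube has side e/2 and centre x, and fits in the metric ball of radius e, which for the sup
   norm is itself a cube. *)
have e20 : 0 < e / 2 by rewrite divr_gt0.
have [y [yb yN]] := null_set_box_escape (\row_j (x 0 j - e / 4)) e20 nB.
have [[By uy] Ly] : (posset (eball 1) u `&` [set y | L < `|partial i u y|]) y.
  apply: He; split => // a b; rewrite ord1 /ball/=.
  by move: (yb b); rewrite mxE ltr_norml; lra.
apply: yN; split => //= -[_]; apply/negP; rewrite -ltNge.
apply: lt_le_trans Ly _.
by have := coord_norm_le_enorm (grad u y) i; rewrite mxE.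
Qed.

(** The segment may cross the free boundary any number of times, so [dist_le_of_derive_where_pos] is
    applied to the restriction of u, differentiable where it is positive. Negative t is reduced to
    positive t by exchanging the end points. *)
Lemma axis_lipschitz x i (t : R) :
  (forall s : R, 0 <= s <= 1 -> eball 1 (x + (s * t) *: delta_mx 0 i)) ->
  `|u (x + t *: delta_mx 0 i) - u x| <= L * `|t|.
Proof.
wlog t0 : x t / 0 <= t.
  move=> W; have [t0|t0] := lerP 0 t; first exact: W.
  move=> seg; have /= := W (x + t *: delta_mx 0 i) (- t).
  rewrite -addrA -scalerDl subrr scale0r addr0 normrN distrC; apply.
    by rewrite oppr_ge0 ltW.
  move=> s sI; have -> : x + t *: delta_mx 0 i + (s * - t) *: delta_mx 0 i =
     x + ((1 - s) * t) *: delta_mx 0 i.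
    by rewrite -addrA -scalerDl; congr (_ + _ *: _); ring.
  by apply: seg; lra.
have [->|tn] := eqVneq t 0.
  by rewrite scale0r addr0 subrr normr0 mulr0.
have tp : 0 < t by rewrite lt_neqAle eq_sym tn.
move=> seg; have {}seg (s : R) : 0 <= s <= t -> eball 1 (x + s *: delta_mx 0 i).
  move=> sI; have := seg (s / t); rewrite divfK//; apply.
  by rewrite divr_ge0 ?ler_pdivrMr// ?mul1r; case/andP: sI.
have := @dist_le_of_derive_where_pos R (fun s => u (x + s *: delta_mx 0 i)) L t t0 L0.
rewrite /= scale0r addr0 (ger0_norm t0); apply.
- move=> s sI; apply: continuous_comp; last exact: admissible_continuous (seg _ sI).
  by apply: cvgD; [exact: cvg_cst|apply: cvgZr_tmp; exact: cvg_id].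
- by move=> s sI; apply: admissible_ge0; exact: seg.
- move=> s sI us; have Ps : posset (eball 1) u (x + s *: delta_mx 0 i) by split => //; exact: seg.
  exists (partial i u (x + s *: delta_mx 0 i)); last exact: partial_norm_le.
  by apply: is_derive_line; exact: admissible_derivable.
Qed.

(** Pass from z to y one coordinate at a time. Each intermediate point is no farther from z than y
    is, so all the segments stay in the ball; the d axis moves account for the factor d. *)
Lemma ball_lipschitz z y (rho : R) : 0 <= rho -> sqn (y - z) <= rho ^+ 2 ->
  (forall p, sqn (p - z) <= rho ^+ 2 -> eball 1 p) ->
  `|u y - u z| <= d%:R * L * rho.
Proof.
move=> r0 yz ball1.
pose q k : 'rV[R]_d := \row_i (if (i < k)%N then y 0 i else z 0 i).
have yzi i : `|y 0 i - z 0 i| <= rho.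
  have := coord_norm_le_enorm (y - z) i; rewrite !mxE => h; apply: le_trans h _.
  by rewrite enorm_le.
have qd : q d = y by apply/rowP => i; rewrite mxE ltn_ord.
have q0 : q 0%N = z by apply/rowP => i; rewrite mxE.
rewrite -[in u y]qd -{1}q0.
suff H k : (k <= d)%N -> `|u (q k) - u (q 0%N)| <= k%:R * L * rho by exact: H.
elim: k => [_|k IH kd]; first by rewrite subrr normr0 !mul0r.
rewrite -natr1 !mulrDl mul1r [leRHS]addrC.
rewrite -[X in `|X|](subrKA (u (q k))).
apply: le_trans (ler_normD _ _) _; apply: lerD; last by apply: IH; exact: ltnW.
pose i0 := Ordinal kd; pose t := y 0 i0 - z 0 i0.
have qE (s : R) i : (q k + (s * t) *: delta_mx 0 i0) 0 i =
    if (i < k)%N then y 0 i else if i == i0 then z 0 i + s * t else z 0 i.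
  rewrite !mxE eqxx/=; case: eqVneq => [->|ii]; last by rewrite mulr0 addr0.
  by rewrite ltnn mulr1.
have qS : q k.+1 = q k + t *: delta_mx 0 i0.
  apply/rowP => i; have := qE 1 i; rewrite mul1r => ->; rewrite mxE ltnS leq_eqVlt.
  rewrite -(inj_eq val_inj)/=; case: eqVneq => //= ik; rewrite ?ltnn.
  have -> : i = i0 by apply: val_inj.
  by rewrite /t; rewrite ltnn addrC subrK.
rewrite qS; apply: le_trans (axis_lipschitz _) _; last first.
  by rewrite ler_wpM2l// yzi.
move=> s sI; apply: ball1; apply: le_trans yz.
apply: ler_sum => i _; have bE (a b : 'rV[R]_d) : (a - b) 0 i = a 0 i - b 0 i by rewrite !mxE.
rewrite !bE qE; case: ifP => // _; case: eqVneq => [->|_]; last by rewrite subrr expr0n sqr_ge0.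
rewrite -/t addrAC subrr add0r exprMn ler_piMl ?sqr_ge0//.
by rewrite expr_le1//; case/andP: sI.
Qed.

End admissible.

(** * One-variable calculus *)

Section derive_real.
Context {R : realType}.
Implicit Types f g : R -> R.

Lemma is_derive_mul f g (x a b : R) : is_derive x (1 : R) f a -> is_derive x (1 : R) g b ->
  is_derive x (1 : R) (fun t => f t * g t) (a * g x + f x * b).
Proof.
move=> fa gb; have h := is_deriveM fa gb.
by apply: is_derive_eq; rewrite addrC; congr (_ + _); exact: mulrC.
Qed.

Lemma is_derive_add f g (x a b : R) : is_derive x (1 : R) f a -> is_derive x (1 : R) g b ->
  is_derive x (1 : R) (fun t => f t + g t) (a + b).
Proof. by move=> fa gb; exact: is_deriveD. Qed.

Lemma is_derive_quadratic (a b c x : R) :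
  is_derive x (1 : R) (fun t => a + b * t + c * t ^+ 2) (b + 2 * c * x).
Proof.
have h (k : R) : is_derive x (1 : R) (fun _ : R => k) 0 by exact: is_derive_cst.
have id : is_derive x (1 : R) (fun t : R => t) 1 by exact: is_derive_id.
have H := is_derive_add (is_derive_add (h a) (is_derive_mul (h b) id))
  (is_derive_mul (h c) (is_derive_mul id id)).
apply: (@is_derive_eq _ _ _ _ _ _ _ _ H); ring.
Qed.

(** The minimum forces [g 0 = 0]. If s were negative, g would be negative just to the right of 0,
    and the mean value theorem would produce values of f below [f 0]. *)
Lemma second_derivative_test f g (s : R) :
  (\forall t \near (0 : R), is_derive t (1 : R) f (g t)) ->
  is_derive (0 : R) (1 : R) g s ->
  (\forall t \near (0 : R), f 0 <= f t) -> 0 <= s.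
Proof.
move=> dfg dg fmin; rewrite leNgt; apply/negP => s0.
have df0 : is_derive (0 : R) (1 : R) f (g 0) by exact: nbhs_singleton dfg.
have small (P : R -> Prop) : (\forall t \near (0 : R), P t) ->
    exists2 e : R, 0 < e & forall t : R, `|t| < e -> P t.
  move=> /nbhs_ballP[e /= e0 H]; exists e => // t te; apply: H.
  by rewrite /ball/= sub0r normrN.
have g0 : g 0 = 0.
  apply/eqP; case: (ltgtP (g 0) 0) => // g0; exfalso.
  - have [e e0 H] := small _ (filterI (derive_lt0_near df0 g0) fmin).
    have e2 : `|e / 2| < e by rewrite gtr0_norm; lra.
    have [+ fe] := H _ e2; rewrite addr0 => /(_ (lt0r_neq0 _)) => /(_ ltac:(lra)).
    by rewrite pmulr_llt0 ?subr_lt0 ?ltNge ?fe//; lra.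
  - have dN : is_derive (0 : R) (1 : R) (- f) (- g 0) by exact: is_deriveN.
    have gN : - g 0 < 0 by rewrite oppr_lt0.
    have [e e0 H] := small _ (filterI (derive_lt0_near dN gN) fmin).
    have e2 : `|- (e / 2)| < e by rewrite normrN gtr0_norm; lra.
    have [+ fe] := H _ e2; rewrite addr0 => /(_ (ltr0_neq0 _)) => /(_ ltac:(lra)).
    rewrite nmulr_llt0 ?subr_gt0; last lra.
    by rewrite /GRing.opp/= ltrN2 ltNge fe.
have [e e0 H] := small _ (filterI (derive_lt0_near dg s0) (filterI dfg fmin)).
have e2 : 0 < e / 2 by rewrite divr_gt0.
have eI (t : R) : 0 <= t <= e / 2 -> `|t| < e by move=> /andP[t0 te]; rewrite ger0_norm; lra.
have [||c] := @MVT R f g 0 (e / 2) e2.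
- by move=> t; rewrite in_itv/= => /andP[t0 te]; apply: (H _ (eI _ _)).2.1; rewrite !ltW.
- apply: continuous_in_subspaceT => t; rewrite mem_setE in_itv => /eI/H[_ [[dt _] _]].
  by apply: differentiable_continuous; apply/derivable1_diffP.
rewrite in_itv/= => /andP[c0 ce] E.
have cI : `|c| < e by apply: eI; rewrite !ltW.
have := (H _ cI).1 (lt0r_neq0 c0); rewrite addr0 g0 subr0 pmulr_llt0// => gc.
have := (H _ (eI (e / 2) _)).2.2; rewrite lexx ltW// => /(_ isT).
by rewrite -subr_ge0 E subr0 leNgt pmulr_llt0// gc.
Qed.

Lemma is_derive_expR_quadratic (a b c x : R) :
  is_derive x (1 : R) (fun t => expR (a + b * t + c * t ^+ 2))
    ((b + 2 * c * x) * expR (a + b * x + c * x ^+ 2)).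
Proof.
have := @is_derive1_comp R expR (fun t => a + b * t + c * t ^+ 2) x _ _
  (is_derive_expR _) (is_derive_quadratic a b c x).
by rewrite mulrC.
Qed.

(** This product is the restriction of a multiple of [half_ball_barrier] to a coordinate line: the
    affine factor is the height, the quadratic one is r^2 - |x|^2, and the exponent is the Gaussian
    weight. *)
Lemma gaussian_product_derive2 (al be h p a b c : R) :
  exists g : R -> R,
    (forall t : R, is_derive t (1 : R)
      (fun t => (al + be * t) * (h - p * t - t ^+ 2) * expR (a + b * t + c * t ^+ 2)) (g t)) /\
    is_derive (0 : R) (1 : R) g
     ((- 2 * be * p - 2 * al + 2 * (be * h - al * p) * b + al * h * (b ^+ 2 + 2 * c)) * expR a).
Proof.
have dl (x : R) : is_derive x (1 : R) (fun t => al + be * t) be.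
  have := is_derive_quadratic al be 0 x.
  have -> : (fun t => al + be * t + 0 * t ^+ 2) = (fun t => al + be * t).
    by apply/funext => t; rewrite mul0r addr0.
  by rewrite mulr0 mul0r addr0.
have dq (x : R) : is_derive x (1 : R) (fun t => h - p * t - t ^+ 2) (- p - 2 * x).
  have := is_derive_quadratic h (- p) (- 1) x.
  have -> : (fun t => h + - p * t + - 1 * t ^+ 2) = (fun t => h - p * t - t ^+ 2).
    by apply/funext => t; ring.
  by rewrite mulrN1 mulNr.
have dm (x : R) : is_derive x (1 : R) (fun t => - p - 2 * t) (- 2).
  have := is_derive_quadratic (- p) (- 2) 0 x.
  have -> : (fun t => - p + - 2 * t + 0 * t ^+ 2) = (fun t => - p - 2 * t).
    by apply/funext => t; ring.
  by rewrite mulr0 mul0r addr0.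
have de (x : R) : is_derive x (1 : R) (fun t => b + 2 * c * t) (2 * c).
  have := is_derive_quadratic b (2 * c) 0 x.
  have -> : (fun t => b + 2 * c * t + 0 * t ^+ 2) = (fun t => b + 2 * c * t).
    by apply/funext => t; ring.
  by rewrite mulr0 mul0r addr0.
have dE x := is_derive_expR_quadratic a b c x.
have dP x := is_derive_mul (dl x) (dq x).
exists (fun t => (be * (h - p * t - t ^+ 2) + (al + be * t) * (- p - 2 * t)) *
    expR (a + b * t + c * t ^+ 2) +
   (al + be * t) * (h - p * t - t ^+ 2) * ((b + 2 * c * t) * expR (a + b * t + c * t ^+ 2))).
split => [t|]; first exact: is_derive_mul (dP t) (dE t).
have db (x : R) : is_derive x (1 : R) (fun _ : R => be) 0 by exact: is_derive_cst.
have H := is_derive_add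
  (is_derive_mul (is_derive_add (is_derive_mul (db 0) (dq 0)) (is_derive_mul (dl 0) (dm 0))) (dE 0))
  (is_derive_mul (dP 0) (is_derive_mul (de 0) (dE 0))).
apply: (@is_derive_eq _ _ _ _ _ _ _ _ H).
rewrite !mulr0 !addr0 expr0n/= !mulr0 !subr0 !addr0; ring.
Qed.
End derive_real.

(** * Superharmonic functions on half balls *)

Section weakly_superharmonic.
Context {R : realType} {d : nat}.
Implicit Types (x z : 'rV[R]_d) (w f psi : 'rV[R]_d -> R) (s : R).

(** Only a first derivative along the line near x and its derivative at x are asked for: this is
    what the second derivative test uses, and it is checked one line at a time. *)
Definition derive2_along f x (i : 'I_d) s : Prop := exists g : R -> R,
  (\forall t \near (0 : R), is_derive t (1 : R) (fun t => f (x + t *: delta_mx 0 i)) (g t)) /\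
  is_derive (0 : R) (1 : R) g s.

(* Viscosity supersolutions: a x_d - u is only continuous across the boundary
   of {u > 0}. *)
Definition weakly_superharmonic w x : Prop := forall psi (s : 'I_d -> R),
  (forall i, derive2_along psi x i (s i)) ->
  (\forall y \near x, w x - psi x <= w y - psi y) -> \sum_i s i <= 0.

Lemma near_along x i (P : 'rV[R]_d -> Prop) :
  (\forall y \near x, P y) -> \forall t \near (0 : R), P (x + t *: delta_mx 0 i).
Proof.
have c : (x + t *: delta_mx 0 i : 'rV[R]_d) @[t --> (0 : R)] --> x + (0 : R) *: delta_mx 0 i.
  by apply: cvgD; [exact: cvg_cst|apply: cvgZr_tmp; exact: cvg_id].
by rewrite scale0r addr0 in c => /c.
Qed.

Lemma derive2_alongB f psi x i (a b : R) :
  derive2_along f x i a -> derive2_along psi x i b ->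
  derive2_along (fun y => f y - psi y) x i (a - b).
Proof.
move=> [g [gf ga]] [k [kf kb]]; exists (fun t => g t - k t); split.
  by apply: filterS2 gf kf => t; exact: is_deriveB.
exact: is_deriveB.
Qed.

Lemma weakly_superharmonic_of_derive2 w x (h : 'I_d -> R) :
  (forall i, derive2_along w x i (h i)) -> \sum_i h i <= 0 -> weakly_superharmonic w x.
Proof.
move=> dw h0 psi s ds wmin; apply: le_trans h0; apply: ler_sum => i _.
rewrite -subr_ge0; have [g [gf gs]] := derive2_alongB (dw i) (ds i).
apply: second_derivative_test gf gs _.
by have := near_along i wmin; apply: filterS => t; rewrite scale0r addr0.
Qed.

(** A test function that touches w from below at x also touches f from below there. *)
Lemma weakly_superharmonic_touch w f x : w x = f x ->
  (\forall y \near x, w y <= f y) -> weakly_superharmonic f x -> weakly_superharmonic w x.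
Proof.
move=> wf wlef sf psi s ds wmin; apply: sf ds _.
apply: filterS2 wlef wmin => y; rewrite wf => h1 h2; apply: le_trans h2 _.
by rewrite lerD2r.
Qed.

Lemma derive2_along_coord (j : 'I_d) (a : R) x i : derive2_along (fun y => a * y 0 j) x i 0.
Proof.
exists (fun=> a * (i == j)%:R); split; last exact: is_derive_cst.
exists (1 : R) => //= t _.
have := is_derive_quadratic (a * x 0 j) (a * (i == j)%:R) 0 t.
rewrite mulr0 mul0r addr0; congr (is_derive _ _ _ _).
apply/funext => {}t; rewrite !mxE eqxx/= eq_sym mul0r addr0; ring.
Qed.

End weakly_superharmonic.

Lemma admissible_derive2 (R : realType) (d : nat) (L : R) (u : 'rV[R]_d -> R) x i :
  admissible L u -> posset (eball 1) u x ->
  derive2_along u x i (partial i (partial i u) x).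
Proof.
move=> uL Px; exists (fun t => partial i u (x + t *: delta_mx 0 i)); split.
  have /(near_along i) := open_nbhs_nbhs (conj (posset_open uL) Px).
  by apply: filterS => t Pt; apply: is_derive_line; exact: (admissible_derivable uL).
have := @is_derive_line _ _ (partial i u) x (delta_mx 0 i) 0.
rewrite scale0r addr0 /=; apply; exact: (admissible_derivable2 uL).
Qed.

(** * The Hopf barrier on half balls *)

Section half_ball.
Context {R : realType} {m : nat}.
Implicit Types (x y z : 'rV[R]_m.+1) (w : 'rV[R]_m.+1 -> R).

Definition half_ball (r : R) : set 'rV[R]_m.+1 := [set x | sqn x <= r ^+ 2 /\ 0 <= xlast x].

Lemma xlast_continuous : continuous (@xlast R m).
Proof. exact: coord_continuous. Qed.

Lemma sqn_le_bounded (r : R) (A : set 'rV[R]_m.+1) :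
  (forall x, A x -> sqn x <= r) -> bounded_set A.
Proof.
move=> Ar; exists (r + 1); split => [|M rM x Ax]; first exact: num_real.
have M0 : 0 <= M.
  by have := le_trans (sqn_ge0 x) (Ar x Ax); move: rM; lra.
rewrite /= [leLHS]/Num.norm/= mx_normrE; apply: bigmax_le => // -[i j] _ /=.
rewrite ord1; have := le_trans (coord_sqr_le_sqn x j) (Ar _ Ax).
have := real_normK (num_real (x 0 j)).
by have := normr_ge0 (x 0 j); move: rM; set a := `|_|; nra.
Qed.

Lemma half_ball_compact (r : R) : compact (half_ball r).
Proof.
apply: bounded_closed_compact; first by apply: (@sqn_le_bounded (r ^+ 2)) => x [].
apply: closedI; first exact: sqn_le_closed.
apply: (@closed_comp _ _ (@xlast R m) [set y | 0 <= y]); last exact: closed_ge.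
by move=> x _; exact: xlast_continuous.
Qed.

Lemma sqnB x z : sqn (x - z) = sqn x + sqn z - 2 * \sum_i x 0 i * z 0 i.
Proof.
rewrite /sqn mulr_sumr -big_split -sumrB; apply: eq_bigr => i _ /=.
by rewrite !mxE; ring.
Qed.

Lemma sqn_addZdelta x (t : R) i :
  sqn (x + t *: delta_mx 0 i) = sqn x + 2 * x 0 i * t + t ^+ 2.
Proof.
rewrite /sqn (bigD1 i)//= [in RHS](bigD1 i)//= !mxE !eqxx/=.
rewrite (eq_bigr (fun j => x 0 j ^+ 2)); last first.
  by move=> j /negbTE ji; rewrite !mxE ji andbF mulr0 addr0.
ring.
Qed.

(* Vanishes on the whole boundary of the half ball, including its corner; for
   large K it is subharmonic away from z (half_ball_barrier_laplacian). *)
Definition half_ball_barrier (r K : R) z x : R :=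
  xlast x * (r ^+ 2 - sqn x) * expR (- K * sqn (x - z)).

Definition half_ball_barrier_derive2 (lam r K : R) z x (i : 'I_m.+1) : R :=
  let be := lam * (i == ord_max)%:R in let al := lam * xlast x in
  let h := r ^+ 2 - sqn x in let p := 2 * x 0 i in
  let b := - 2 * K * (x 0 i - z 0 i) in
  (- 2 * be * p - 2 * al + 2 * (be * h - al * p) * b + al * h * (b ^+ 2 + 2 * - K)) *
    expR (- K * sqn (x - z)).

Lemma derive2_along_half_ball_barrier (lam r K : R) z x i :
  derive2_along (fun y => lam * half_ball_barrier r K z y) x i
    (half_ball_barrier_derive2 lam r K z x i).
Proof.
have [g [gd g0]] := gaussian_product_derive2 (lam * xlast x) (lam * (i == ord_max)%:R)
  (r ^+ 2 - sqn x) (2 * x 0 i) (- K * sqn (x - z)) (- 2 * K * (x 0 i - z 0 i)) (- K).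
exists g; split; last exact: g0.
exists (1 : R) => //= t _; have := gd t; congr (is_derive _ _ _ _).
apply/funext => {}t; rewrite /half_ball_barrier.
have -> : x + t *: delta_mx 0 i - z = x - z + t *: delta_mx 0 i by rewrite addrAC.
rewrite !sqn_addZdelta /xlast !mxE eqxx/= eq_sym.
have -> : - K * sqn (x - z) + -2 * K * (x 0 i - z 0 i) * t + - K * t ^+ 2 =
  - K * (sqn (x - z) + 2 * (x 0 i - z 0 i) * t + t ^+ 2) by ring.
ring.
Qed.

(** The terms are grouped by sign. The negative Laplacian of x_d (r^2 - |x|^2), equal to -(2d + 4)
    x_d, is absorbed into the first group, nonnegative for large K since |z| < r; the second is
    positive inside because [xlast z] is; the third is nonnegative away from z for large K; the last
    always is. *)
Lemma half_ball_barrier_laplacian (lam r K : R) z x :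
  \sum_i half_ball_barrier_derive2 lam r K z x i =
  lam * expR (- K * sqn (x - z)) *
    (xlast x * (4 * K * (r ^+ 2 - sqn z) - (2 * m.+1%:R + 4)) +
     4 * K * (r ^+ 2 - sqn x) * xlast z +
     xlast x * (r ^+ 2 - sqn x) * (4 * K ^+ 2 * sqn (x - z) - 2 * m.+1%:R * K - 8 * K) +
     4 * K * xlast x * sqn (x - z)).
Proof.
pose h := r ^+ 2 - sqn x; pose E := expR (- K * sqn (x - z)).
have S1 (f : 'I_m.+1 -> R) : \sum_i (i == ord_max)%:R * f i = f ord_max.
  by rewrite (bigD1 ord_max)//= eqxx mul1r big1 ?addr0// => i /negbTE ->; rewrite mul0r.
have -> : \sum_i half_ball_barrier_derive2 lam r K z x i =
  \sum_i (lam * E * (- 2 * xlast x - 2 * xlast x * h * K) +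
   lam * E * ((i == ord_max)%:R * (- 4 * x 0 i - 4 * K * h * (x 0 i - z 0 i))) +
   lam * E * 8 * K * xlast x * x 0 i ^+ 2 - lam * E * 8 * K * xlast x * (x 0 i * z 0 i) +
   lam * E * 4 * K ^+ 2 * xlast x * h * (x - z) 0 i ^+ 2).
  apply: eq_bigr => i _; rewrite /half_ball_barrier_derive2 -/h -/E !mxE; ring.
rewrite !big_split/= sumrN -!mulr_sumr S1 sumr_const card_ord -/(sqn x) -/(sqn (x - z)).
have -> : \sum_i x 0 i * z 0 i = (sqn x + sqn z - sqn (x - z)) / 2.
  by rewrite sqnB; field.
by rewrite /h /xlast /E; field.
Qed.

End half_ball.

Section half_ball_comparison.
Context {R : realType} {m : nat}.
Implicit Types (x y z : 'rV[R]_m.+1) (w : 'rV[R]_m.+1 -> R).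

(** Maximum principle. A negative minimum of w minus the scaled barrier is not on the boundary,
    where the barrier vanishes, nor within rho of z, where w is at least eps while the barrier is at
    most r^3. Elsewhere the scaled barrier is a test function for w with positive Laplacian. *)
Lemma half_ball_lower_bound (r rho K eps : R) z w :
  0 < r -> 0 < eps -> 0 < K -> 0 < xlast z -> sqn z <= r ^+ 2 ->
  2 * m.+1%:R + 4 <= 4 * K * (r ^+ 2 - sqn z) ->
  2 * m.+1%:R + 8 <= 4 * K * rho ^+ 2 ->
  (forall x, half_ball r x -> {for x, continuous w}) ->
  (forall x, half_ball r x -> 0 <= w x) ->
  (forall x, sqn x < r ^+ 2 -> 0 < xlast x -> weakly_superharmonic w x) ->
  (forall x, half_ball r x -> sqn (x - z) <= rho ^+ 2 -> eps <= w x) ->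
  forall x, half_ball r x -> eps / r ^+ 3 * half_ball_barrier r K z x <= w x.
Proof.
move=> r0 eps0 K0 z0 zr hK1 hK2 cw w0 sw wz x0 x0H.
pose lam := eps / r ^+ 3; rewrite -/lam.
have lam0 : 0 < lam by rewrite divr_gt0 ?exprn_gt0.
pose f x := w x - lam * half_ball_barrier r K z x.
have cb : continuous (fun x => lam * half_ball_barrier r K z x).
  move=> x.
  have c1 : {for x, continuous (@xlast R m)} by exact: xlast_continuous.
  have c2 : {for x, continuous (fun y => r ^+ 2 - sqn y)}.
    by apply: continuousB; [exact: cst_continuous|exact: sqn_continuous].
  have c3 : {for x, continuous (fun y => sqn (y - z))}.
    apply: continuous_comp; last exact: sqn_continuous.
    by apply: continuousB; [exact: cvg_id|exact: cst_continuous].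
  have c4 : {for x, continuous (fun y => expR (- K * sqn (y - z)))}.
    apply: continuous_comp; last exact: continuous_expR.
    exact: continuousM (@cst_continuous _ _ (- K) x) c3.
  exact: continuousM (@cst_continuous _ _ lam x) (continuousM (continuousM c1 c2) c4).
have cf : {within half_ball r, continuous f}.
  apply: continuous_in_subspaceT => x; rewrite inE => Hx.
  exact: continuousB (cw _ Hx) (cb x).
have [c + cmin] := @compact_EVT_min _ _ f _ (ex_intro _ x0 x0H) (@half_ball_compact R m r) cf.
rewrite inE => cH.
have x0in : x0 \in half_ball r by rewrite inE.
rewrite -subr_ge0; apply: le_trans (cmin _ x0in).
rewrite leNgt; apply/negP => fc.
have [cr c0] := cH.
have b0 : 0 <= w c by exact: w0.
have wc : w c < lam * half_ball_barrier r K z c by rewrite -subr_lt0.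
have e0 : 0 < expR (- K * sqn (c - z)) by exact: expR_gt0.
have cr' : sqn c < r ^+ 2.
  rewrite lt_neqAle cr andbT; apply/negP => /eqP E.
  by move: wc; rewrite /half_ball_barrier E subrr mulr0 mul0r mulr0 ltNge b0.
have c0' : 0 < xlast c.
  rewrite lt_neqAle c0 andbT eq_sym; apply/negP => /eqP E.
  by move: wc; rewrite /half_ball_barrier E mul0r mul0r mulr0 ltNge b0.
have cz : rho ^+ 2 < sqn (c - z).
  rewrite ltNge; apply/negP => /(wz _ cH); apply/negP; rewrite -ltNge.
  apply: lt_le_trans wc _.
  have -> : eps = lam * (r * r ^+ 2 * 1).
    by rewrite /lam; field; rewrite gt_eqF.
  rewrite ler_pM2l// /half_ball_barrier ler_pM ?mulr_ge0 ?(ltW e0)//.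
  - by rewrite subr_ge0.
  - rewrite ler_pM ?subr_ge0//; last by rewrite gerBl sqn_ge0.
    apply: le_trans (ler_norm _) _; apply: le_trans (coord_norm_le_enorm _ _) _.
    by rewrite enorm_le// ltW.
  - by rewrite expR_le1 mulNr oppr_le0 mulr_ge0 ?sqn_ge0// ltW.
have : \sum_i half_ball_barrier_derive2 lam r K z c i <= 0.
  apply: (sw c cr' c0') => [i|]; first exact: derive2_along_half_ball_barrier.
  have h1 : nbhs c [set y | sqn y < r ^+ 2].
    by apply: (sqn_continuous (lt_nbhsl cr')).
  have h2 : nbhs c [set y | 0 < xlast y].
    by apply: (xlast_continuous (lt_nbhsr c0')).
  apply: filterS2 h1 h2 => y /= h1 h2; apply: cmin; rewrite inE; split; exact: ltW.
rewrite half_ball_barrier_laplacian leNgt => /negP; apply.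
apply: mulr_gt0; first exact: mulr_gt0.
have h0 : 0 < r ^+ 2 - sqn c by rewrite subr_gt0.
have q0 : 0 <= sqn (c - z) by exact: sqn_ge0.
have t1 : 0 <= xlast c * (4 * K * (r ^+ 2 - sqn z) - (2 * m.+1%:R + 4)).
  by rewrite mulr_ge0// subr_ge0.
have t2 : 0 < 4 * K * (r ^+ 2 - sqn c) * xlast z by rewrite !mulr_gt0.
have t3 : 0 <= xlast c * (r ^+ 2 - sqn c) *
    (4 * K ^+ 2 * sqn (c - z) - 2 * m.+1%:R * K - 8 * K).
  rewrite mulr_ge0//; first by rewrite mulr_ge0// ltW.
  have -> : 4 * K ^+ 2 * sqn (c - z) - 2 * m.+1%:R * K - 8 * K =
    K * (4 * K * sqn (c - z) - (2 * m.+1%:R + 8)) by ring.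
  rewrite mulr_ge0// ?ltW// subr_gt0; apply: le_lt_trans hK2 _.
  by rewrite ltr_pM2l// mulr_gt0.
have t4 : 0 <= 4 * K * xlast c * sqn (c - z) by rewrite !mulr_ge0// ltW.
lra.
Qed.

End half_ball_comparison.

Section half_ball_growth.
Context {R : realType} {m : nat}.
Implicit Types (x y z : 'rV[R]_m.+1) (w : 'rV[R]_m.+1 -> R).

Lemma sqn_sub_le x z : sqn (x - z) <= 2 * sqn x + 2 * sqn z.
Proof.
rewrite /sqn !mulr_sumr -big_split; apply: ler_sum => i _ /=.
by rewrite !mxE; have := sqr_ge0 (x 0 i + z 0 i); nra.
Qed.

(** Taking K proportional to r^-2 in [half_ball_lower_bound] makes theta independent of r; on
    [half_ball (r / 2)] the barrier is bounded below by a multiple of r^2 x_d. *)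
Lemma half_ball_growth (rho : R) : 0 < rho ->
  exists2 theta : R, 0 < theta & forall (r eps : R) z w,
    0 < r -> 0 < eps -> 0 < xlast z -> sqn z <= (15 / 16 * r) ^+ 2 ->
    (forall x, half_ball r x -> {for x, continuous w}) ->
    (forall x, half_ball r x -> 0 <= w x) ->
    (forall x, sqn x < r ^+ 2 -> 0 < xlast x -> weakly_superharmonic w x) ->
    (forall x, half_ball r x -> sqn (x - z) <= (rho * r) ^+ 2 -> eps <= w x) ->
    forall x, half_ball (r / 2) x -> theta * (eps / r) * xlast x <= w x.
Proof.
(* The summand 3 serves the condition on z, where r^2 - |z|^2 is at least (31/256) r^2 and 12 *
   31/256 > 1; the summand rho^-2 serves the region at distance rho r from z. *)
move=> rho0; pose D : R := 2 * m.+1%:R + 8; pose k := D * (3 + rho ^- 2).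
have D0 : 0 < D by rewrite addr_gt0// mulr_gt0.
have i0 : 0 < rho ^- 2 by rewrite invr_gt0 exprn_gt0.
have k3 : 3 * D <= k by rewrite /k mulrC ler_pM2l//; lra.
have kr : D <= k * rho ^+ 2.
  rewrite /k mulrDr mulrDl divfK ?gt_eqF ?exprn_gt0// lerDr.
  by rewrite !mulr_ge0 ?sqr_ge0// ltW.
have k0 : 0 < k by lra.
(* On the smaller half ball r^2 - |x|^2 is at least (3/4) r^2, and |x - z|^2 is at most 4 r^2. *)
exists (3 / 4 * expR (- (4 * k))); first by rewrite mulr_gt0 ?expR_gt0// divr_gt0.
move=> r eps z w r0 eps0 z0 zr cw w0 sw wz x [xr x0].
have r2 : 0 < r ^+ 2 by rewrite exprn_gt0.
have xr' : half_ball r x.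
  by split => //; apply: le_trans xr _; rewrite expr_div_n; lra.
have zr' : sqn z <= 225 / 256 * r ^+ 2 by move: zr; rewrite exprMn expr_div_n; lra.
have H := @half_ball_lower_bound R m r (rho * r) (k / r ^+ 2) eps z w r0 eps0.
apply: le_trans (H _ z0 _ _ _ cw w0 sw wz x xr'); last 4 first.
- by rewrite divr_gt0.
- lra.
- have -> : 4 * (k / r ^+ 2) * (r ^+ 2 - sqn z) = 4 * k * ((r ^+ 2 - sqn z) / r ^+ 2) by ring.
  have : 31 / 256 <= (r ^+ 2 - sqn z) / r ^+ 2 by rewrite ler_pdivlMr//; lra.
  move=> /(ler_wpM2l (ltW k0)) h; move: k3 D0 h; rewrite /D.
  by rewrite -[4 * k * _]mulrA; lra.
- have -> : 4 * (k / r ^+ 2) * (rho * r) ^+ 2 = 4 * (k * rho ^+ 2).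
    by field; rewrite gt_eqF.
  by move: kr D0; rewrite /D; lra.
have -> : 3 / 4 * expR (- (4 * k)) * (eps / r) * xlast x =
   eps / r ^+ 3 * (xlast x * (3 / 4 * r ^+ 2) * expR (- (4 * k))).
  by field; rewrite gt_eqF.
rewrite ler_pM2l ?divr_gt0 ?exprn_gt0// /half_ball_barrier.
apply: ler_pM; rewrite ?expR_ge0//.
- by rewrite !mulr_ge0 ?divr_ge0// ltW.
- rewrite ler_wpM2l//; move: xr; rewrite expr_div_n; lra.
- have h : sqn (x - z) <= 4 * r ^+ 2.
    by apply: le_trans (sqn_sub_le _ _) _; move: xr; rewrite expr_div_n; lra.
  rewrite ler_expR mulNr lerN2 mulrAC ler_pdivrMr//.
  by apply: le_trans (ler_wpM2l (ltW k0) h) _; rewrite mulrA [k * 4]mulrC.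
Qed.

End half_ball_growth.

(** * Comparison with quadratic test functions *)

Section quadratic_test_function.
Context {R : realType} {m : nat}.
Implicit Types (x y p : 'rV[R]_m.+1) (V : set 'rV[R]_m.+1) (u f : 'rV[R]_m.+1 -> R).

Lemma is_derive_of_line (f : 'rV[R]_m.+1 -> R) x v (a : R) :
  is_derive (0 : R) (1 : R) (fun t : R => f (x + t *: v)) a -> is_derive x v f a.
Proof.
have E : (fun h : R => h^-1 *: (f (x + (h *: (1 : R) + 0) *: v) - f (x + (0 : R) *: v))) =
         (fun h : R => h^-1 *: (f (h *: v + x) - f x)).
  apply/funext => h; rewrite scale0r !addr0; congr (_ *: (f _ - _)).
  by rewrite addrC; congr (_ *: _ + _); exact: mulr1.
by case => dh hE; split; [move: dh; rewrite /derivable /= E|move: hE; rewrite /derive /= E].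
Qed.

Lemma is_derive_of_quadratic_line f x v (a b : R) :
  (forall t : R, f (x + t *: v) = f x + a * t + b * t ^+ 2) -> is_derive x v f a.
Proof.
move=> fE; apply: is_derive_of_line; have := is_derive_quadratic (f x) a b 0.
by rewrite mulr0 addr0; congr (is_derive _ _ _ _); apply/funext => t.
Qed.

Lemma Ck_on_cst k V (c : R) : Ck_on k V (fun _ : 'rV[R]_m.+1 => c).
Proof.
elim: k c => [|k IH] c;
  (split; first by apply: continuous_subspaceT; exact: cst_continuous) => // i.
split => [x _|]; first exact: derivable_cst.
rewrite (_ : partial i _ = fun=> 0); first exact: IH.
by apply/funext => x; rewrite /partial derive_cst.
Qed.

Lemma coord_addZdelta x (t : R) i j : (x + t *: delta_mx 0 i) 0 j = x 0 j + (j == i)%:R * t.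
Proof. by rewrite !mxE eqxx/= mulrC. Qed.

(** This is the shape of the first derivatives of [qtest]. *)
Lemma Ck_on_affine k V i (a b c : R) :
  Ck_on k V (fun x => a + b * x 0 i + c * xlast x).
Proof.
have cont : continuous (fun x : 'rV[R]_m.+1 => a + b * x 0 i + c * xlast x).
  move=> x.
  have c1 : {for x, continuous (fun y : 'rV[R]_m.+1 => y 0 i)} by exact: coord_continuous.
  have c2 : {for x, continuous (@xlast R m)} by exact: coord_continuous.
  exact: continuousD (continuousD (@cst_continuous _ _ a x)
    (continuousM (@cst_continuous _ _ b x) c1)) (continuousM (@cst_continuous _ _ c x) c2).
have dE x j : is_derive x (delta_mx 0 j) (fun x => a + b * x 0 i + c * xlast x)
    (b * (i == j)%:R + c * (ord_max == j)%:R).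
  apply: (@is_derive_of_quadratic_line _ _ _ _ 0) => t.
  by rewrite /xlast !coord_addZdelta; ring.
case: k => [|k]; (split; first exact: continuous_subspaceT) => // j.
split => [x _|]; first by case: (dE x j).
rewrite (_ : partial j _ = fun=> b * (i == j)%:R + c * (ord_max == j)%:R).
  exact: Ck_on_cst.
by apply/funext => x; rewrite /partial derive_val.
Qed.

(** Near p this is a tilted plane of slope b. The term in A separates values at p from those on a
    sphere around p, the term in C fixes the sign of the Laplacian, and sig moves the zero level.
    Upper barriers use negative sig, A and C. *)
Definition qtest (b sig A C : R) p x : R :=
  b * (xlast x + sig - A * sqn (x - p) + C * xlast x ^+ 2).

Lemma qtest_continuous (b sig A C : R) p : continuous (qtest b sig A C p).
Proof.
move=> x.
have c1 : {for x, continuous (@xlast R m)} by exact: coord_continuous.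
have c3 : {for x, continuous (fun y => sqn (y - p))}.
  apply: continuous_comp; last exact: sqn_continuous.
  by apply: continuousB; [exact: cvg_id|exact: cst_continuous].
have c4 : {for x, continuous (fun y : 'rV[R]_m.+1 => xlast y ^+ 2)}.
  exact: (continuousM c1 c1).
have k (c : R) : {for x, continuous (fun=> c)} by exact: cst_continuous.
exact: continuousM (k b) (continuousD (continuousB (continuousD c1 (k sig))
  (continuousM (k A) c3)) (continuousM (k C) c4)).
Qed.

Definition qtest_partial (b A C : R) p x i : R :=
  b * ((i == ord_max)%:R * (1 + 2 * C * xlast x) - 2 * A * (x 0 i - p 0 i)).

Lemma is_derive_qtest (b sig A C : R) p x i :
  is_derive x (delta_mx 0 i) (qtest b sig A C p) (qtest_partial b A C p x i).
Proof.
apply: (@is_derive_of_quadratic_line _ _ _ _ (b * ((i == ord_max)%:R ^+ 2 * C - A))) => t.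
rewrite /qtest /qtest_partial.
have -> : x + t *: delta_mx 0 i - p = x - p + t *: delta_mx 0 i by rewrite addrAC.
rewrite sqn_addZdelta /xlast !coord_addZdelta !mxE [ord_max == i]eq_sym; ring.
Qed.

Lemma partial_qtest (b sig A C : R) p i :
  partial i (qtest b sig A C p) = fun x => b * ((i == ord_max)%:R + 2 * A * p 0 i) +
    (- 2 * b * A) * x 0 i + (2 * b * C * (i == ord_max)%:R) * xlast x.
Proof.
apply/funext => x; have h := is_derive_qtest b sig A C p x i.
by rewrite /partial derive_val /qtest_partial; ring.
Qed.

Lemma smooth_on_qtest V (b sig A C : R) p : smooth_on V (qtest b sig A C p).
Proof.
have cont := continuous_subspaceT (@qtest_continuous b sig A C p).
case=> [|k]; (split; first exact: cont) => // i; split => [x _|].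
  by case: (is_derive_qtest b sig A C p x i).
by rewrite partial_qtest; exact: Ck_on_affine.
Qed.

Lemma grad_qtest (b sig A C : R) p x i :
  grad (qtest b sig A C p) x 0 i = qtest_partial b A C p x i.
Proof.
by rewrite mxE; have h := is_derive_qtest b sig A C p x i; rewrite /partial derive_val.
Qed.

Lemma laplacian_qtest (b sig A C : R) p x :
  laplacian (qtest b sig A C p) x = 2 * b * (C - m.+1%:R * A).
Proof.
have E i : partial i (partial i (qtest b sig A C p)) x =
    - 2 * b * A + (2 * b * C) * (i == ord_max)%:R.
  rewrite partial_qtest /partial.
  have h : is_derive x (delta_mx 0 i) (fun x => b * ((i == ord_max)%:R + 2 * A * p 0 i) +
    (- 2 * b * A) * x 0 i + (2 * b * C * (i == ord_max)%:R) * xlast x)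
    (- 2 * b * A + (2 * b * C) * (i == ord_max)%:R).
    apply: (@is_derive_of_quadratic_line _ _ _ _ 0) => t.
    rewrite /xlast !coord_addZdelta eqxx [ord_max == i]eq_sym.
    by case: (i == ord_max); rewrite /= ?mulr1n ?mulr0n; ring.
  by rewrite derive_val.
rewrite /laplacian (eq_bigr _ (fun i _ => E i)) big_split/= sumr_const card_ord -mulr_sumr.
rewrite (bigD1 ord_max)//= eqxx big1 ?addr0; last by move=> i /negbTE ->.
by rewrite /= -[X in X + _]mulr_natr; ring.
Qed.

Lemma enorm_grad_qtest_ge (b sig A C : R) p x : xlast p = 0 ->
  b * (1 + 2 * (C - A) * xlast x) <= enorm (grad (qtest b sig A C p) x).
Proof.
move=> p0; apply: le_trans (coord_norm_le_enorm _ ord_max).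
apply: le_trans (ler_norm _); rewrite grad_qtest /qtest_partial eqxx.
by move: p0; rewrite /xlast /= mulr1n => ->; rewrite le_eqVlt; apply/orP; left; apply/eqP; ring.
Qed.

Lemma sqn_grad_qtest (b sig A C : R) p x : xlast p = 0 ->
  sqn (grad (qtest b sig A C p) x) =
  b ^+ 2 * ((1 + 2 * (C - A) * xlast x) ^+ 2 + 4 * A ^+ 2 * (sqn (x - p) - xlast x ^+ 2)).
Proof.
move=> p0; rewrite /sqn (bigD1 ord_max)//= [X in _ * (_ + _ * (X - _))](bigD1 ord_max)//=.
rewrite grad_qtest /qtest_partial eqxx
  (eq_bigr (fun i => b ^+ 2 * (4 * A ^+ 2) * (x - p) 0 i ^+ 2)).
  rewrite -mulr_sumr; set S := \sum_(i < _ | _) _.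
  by rewrite !mxE; move: p0; rewrite /xlast /= mulr1n => ->; ring.
by move=> i /negbTE im; rewrite grad_qtest /qtest_partial im !mxE /= mulr0n; ring.
Qed.

(** Vertical translates stay in the family, with the same gradient and Laplacian, which is where b
    must be nonzero. *)
Lemma qtest_shift (b sig A C M : R) p x : b != 0 ->
  qtest b (sig + M / b) A C p x = qtest b sig A C p x + M.
Proof. by move=> b0; rewrite /qtest; field. Qed.

(* No sliding is needed: if u - phi has a positive maximum M, then phi + M is
   itself a forbidden test function. *)
Lemma slope_ge_comparison (s b sig A C : R) p V (K : set 'rV[R]_m.+1) u :
  b != 0 -> slope_ge s V u -> compact K ->
  (forall x, K x -> {for x, continuous u}) ->
  (forall x, K x -> closure (posset V u) x -> u x <= qtest b sig A C p x \/
    [/\ V x, nbhs x K, laplacian (qtest b sig A C p) x < 0 &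
        enorm (grad (qtest b sig A C p) x) < s]) ->
  forall x, K x -> closure (posset V u) x -> u x <= qtest b sig A C p x.
Proof.
move=> b0 su cK cu H x0 Kx0 x0c.
pose F := K `&` closure (posset V u); pose f x := u x - qtest b sig A C p x.
have cF : compact F by apply: compact_closedI => //; exact: closed_closure.
have cf : {within F, continuous f}.
  apply: continuous_in_subspaceT => x; rewrite inE => -[Kx _].
  exact: continuousB (cu _ Kx) (@qtest_continuous _ _ _ _ _ x).
have [c + cmax] := @compact_EVT_max _ _ f _ (ex_intro _ x0 (conj Kx0 x0c)) cF cf.
rewrite inE => -[Kc cc]; rewrite -subr_le0.
have := cmax x0; rewrite inE => /(_ (conj Kx0 x0c)) h; apply: le_trans h _.
rewrite leNgt; apply/negP => fc0.
have [fc|[Vc nK lap gr]] := H c Kc cc; first by move: fc0; rewrite /f ltNge subr_le0 fc.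
have := su (qtest b (sig + f c / b) A C p) c (@smooth_on_qtest _ _ _ _ _ _) Vc.
case.
- split => //; first by rewrite qtest_shift// /f; lra.
  apply: filterS nK => y Ky cy _; rewrite !qtest_shift//.
  by have := cmax y; rewrite inE => /(_ (conj Ky cy)); rewrite /f; lra.
- by move: lap; rewrite !laplacian_qtest; lra.
- move=> [_]; rewrite leNgt => /negP; apply; move: gr.
  congr (enorm _ < _); apply/rowP => i; by rewrite !grad_qtest.
Qed.

(** The mirror argument at a negative minimum of u - phi. Touching from below is tested on a full
    neighbourhood, so the whole of K enters and not only the closure of {u > 0}. *)
Lemma slope_le_comparison (s b sig A C : R) p V (K : set 'rV[R]_m.+1) u :
  b != 0 -> slope_le s V u -> compact K ->
  (forall x, K x -> {for x, continuous u}) ->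
  (forall x, K x -> qtest b sig A C p x <= u x \/
    [/\ V x, nbhs x K, 0 < laplacian (qtest b sig A C p) x &
        s < enorm (grad (qtest b sig A C p) x)]) ->
  forall x, K x -> qtest b sig A C p x <= u x.
Proof.
move=> b0 su cK cu H x0 Kx0.
pose f x := u x - qtest b sig A C p x.
have cf : {within K, continuous f}.
  apply: continuous_in_subspaceT => x; rewrite inE => Kx.
  exact: continuousB (cu _ Kx) (@qtest_continuous _ _ _ _ _ x).
have [c + cmin] := @compact_EVT_min _ _ f _ (ex_intro _ x0 Kx0) cK cf.
rewrite inE => Kc; rewrite -subr_ge0.
have := cmin x0; rewrite inE => /(_ Kx0) h; apply: le_trans h.
rewrite leNgt; apply/negP => fc0.
have [fc|[Vc nK lap gr]] := H c Kc; first by move: fc0; rewrite /f ltNge subr_ge0 fc.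
have := su (qtest b (sig + f c / b) A C p) c (@smooth_on_qtest _ _ _ _ _ _) Vc.
case.
- split => //; first by rewrite qtest_shift// /f; lra.
  apply: filterS nK => y Ky _; rewrite !qtest_shift//.
  by have := cmin y; rewrite inE => /(_ Ky); rewrite /f; lra.
- by move: lap; rewrite !laplacian_qtest; lra.
- move=> [_]; rewrite leNgt => /negP; apply; move: gr.
  congr (_ < enorm _); apply/rowP => i; by rewrite !grad_qtest.
Qed.

End quadratic_test_function.

(** * Improvement of slope *)

Section flat_point_barriers.
Context {R : realType} {m : nat}.
Implicit Types (x y z p : 'rV[R]_m.+1) (V : set 'rV[R]_m.+1) (u : 'rV[R]_m.+1 -> R).
Local Notation d := (m.+1%:R : R).

Definition cball p (r : R) : set 'rV[R]_m.+1 := [set x | sqn (x - p) <= r ^+ 2].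

Lemma sqnB_continuous p : continuous (fun x => sqn (x - p)).
Proof.
move=> x; apply: continuous_comp; last exact: sqn_continuous.
by apply: continuousB; [exact: cvg_id|exact: cst_continuous].
Qed.

(** The weight 5/4 is close enough to 1 that |z| <= 3/4 and |x - z| <= 1/32 keep x inside B_1. *)
Lemma sqn_le_split x z : sqn x <= 5 / 4 * sqn z + 5 * sqn (x - z).
Proof.
rewrite /sqn !mulr_sumr -big_split; apply: ler_sum => i _ /=.
by rewrite !mxE; have := sqr_ge0 (5 * (x 0 i - z 0 i) - x 0 i); nra.
Qed.

Lemma sqn_le_split2 x z : sqn x <= 2 * sqn z + 2 * sqn (x - z).
Proof.
rewrite /sqn !mulr_sumr -big_split; apply: ler_sum => i _ /=.
by rewrite !mxE; have := sqr_ge0 (x 0 i - 2 * z 0 i); nra.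
Qed.

Lemma cball_compact p (r : R) : compact (cball p r).
Proof.
apply: bounded_closed_compact.
  apply: (@sqn_le_bounded _ _ (2 * sqn p + 2 * r ^+ 2)) => x xp.
  by apply: le_trans (sqn_le_split2 x p) _; rewrite lerD2l ler_pM2l.
apply: (@closed_comp _ _ (fun x => sqn (x - p)) [set y | y <= r ^+ 2]); last exact: closed_le.
by move=> x _; exact: sqnB_continuous.
Qed.

Lemma cball_nbhs p (r : R) x : sqn (x - p) < r ^+ 2 -> nbhs x (cball p r).
Proof.
move=> xp; have h : nbhs x [set y | sqn (y - p) < r ^+ 2].
  exact: (sqnB_continuous (lt_nbhsl xp)).
by apply: filterS h => y; exact: ltW.
Qed.

Lemma xlast_sqr_le p x : xlast p = 0 -> xlast x ^+ 2 <= sqn (x - p).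
Proof.
move=> p0; have := coord_sqr_le_sqn (x - p) ord_max.
by rewrite !mxE; move: p0; rewrite /xlast => ->; rewrite subr0.
Qed.

Lemma cball_xlast p (r : R) x : xlast p = 0 -> 0 <= r -> cball p r x -> - r <= xlast x <= r.
Proof.
move=> p0 r0 xp; have h := le_trans (xlast_sqr_le x p0) xp.
by rewrite -ler_norml -(ler_pXn2r (ltn0Sn 1)) ?nnegrE// real_normK// num_real.
Qed.

(** An upper barrier of slope b strictly between a and s is superharmonic with gradient below s, and
    dominates a x_d on the sphere of radius r/4. Hence u lies below it on the closure of {u > 0};
    but it is negative near p, where u is nonnegative. *)
Lemma slope_ge_vanishing (c : R) : 0 < c <= 1 ->
  exists2 rho : R, 0 < rho <= 4^-1 & forall (s r a : R) p V u,
    0 < s -> 0 < r -> xlast p = 0 -> a <= s * (1 - c) ->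
    slope_ge s V u -> cball p (r / 4) `<=` V ->
    (forall x, cball p (r / 4) x -> {for x, continuous u} /\ 0 <= u x) ->
    (forall x, cball p (r / 4) x -> closure (posset V u) x ->
      0 <= xlast x /\ u x <= a * xlast x) ->
    forall y, cball p (rho * r) y -> ~ closure (posset V u) y.
Proof.
move=> /andP[c0 c1].
have d0 : 1 <= d by rewrite ler1n.
(* With [C = (d + 1) * A] the Laplacian is [- (2 * b * A)], and this A0 gives [C * r = c], so the
   factor [1 - C * xlast x] lowers the slope by at most a quarter of c. *)
have [A0 A0E] : exists A0, A0 = c / (d + 1) by eexists.
have A0p : 0 < A0 by rewrite A0E divr_gt0//; lra.
have dA0 : (d + 1) * A0 = c by rewrite A0E; field; lra.
have A0c : A0 <= c / 2 by move: dA0; nra.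
exists (A0 / 32); first by rewrite divr_gt0//=; lra.
move=> s r a p V u s0 r0 p0 ac su KV Ku KU y yp yc.
have r4 : 0 < r / 4 by rewrite divr_gt0.
have [A AE] : exists A, A = A0 / r by eexists.
have [C CE] : exists C, C = (d + 1) * A by eexists.
have [b bE] : exists b, b = s * (1 - c / 2) by eexists.
(* This is A (r/4)^2: on the sphere the constant cancels the term in |x - p|^2, leaving a multiple
   of x_d. *)
have [sig sigE] : exists sig, sig = A0 * r / 16 by eexists.
have b0 : 0 < b by rewrite bE mulr_gt0//; lra.
have A1 : 0 < A by rewrite AE divr_gt0.
have Ar : A * r = A0 by rewrite AE divfK// gt_eqF.
have Cp : 0 < C by rewrite CE mulr_gt0//; lra.
have Cr : C * r = c by rewrite CE -mulrA Ar.
have lap x : laplacian (qtest b (- sig) (- A) (- C) p) x < 0.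
  rewrite laplacian_qtest.
  have -> : 2 * b * (- C - d * - A) = - (2 * b * A) by rewrite CE; ring.
  by rewrite oppr_lt0 !mulr_gt0.
have cmp x : cball p (r / 4) x -> closure (posset V u) x ->
    u x <= qtest b (- sig) (- A) (- C) p x.
  apply: (slope_ge_comparison (s := s) (V := V)) => //.
  - by rewrite gt_eqF.
  - exact: cball_compact.
  - by move=> {}x /Ku[].
  move=> {}x Kx cx; have [x0 ux] := KU x Kx cx.
  have /andP[_ xr] := cball_xlast p0 (ltW r4) Kx.
  have [Ex|xlt] := eqVneq (sqn (x - p)) ((r / 4) ^+ 2).
    left; apply: le_trans ux _; apply: (@le_trans _ _ (s * (1 - c) * xlast x)).
      by rewrite ler_wpM2r.
    have -> : qtest b (- sig) (- A) (- C) p x = b * (1 - C * xlast x) * xlast x.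
      by rewrite /qtest Ex sigE -Ar; field.
    rewrite ler_wpM2r// bE -[leRHS]mulrA ler_pM2l//.
    have : C * xlast x <= c / 4.
      have : C * xlast x <= C * (r / 4) by rewrite ler_pM2l.
      by rewrite mulrA Cr.
    by nra.
  right; split => //; first exact: KV.
    by apply: cball_nbhs; rewrite lt_neqAle xlt.
  rewrite enorm_lt ?ltW// sqn_grad_qtest//.
  have t1 : 0 <= 2 * d * A * xlast x <= 1.
    apply/andP; split; first by rewrite !mulr_ge0// ltW.
    have : d * A * xlast x <= d * A * (r / 4) by rewrite ler_wpM2l// mulr_ge0// ltW.
    by have -> : d * A * (r / 4) = d * (A * r) / 4 by [ring|]; rewrite Ar; lra.
  have t2 : 4 * (- A) ^+ 2 * (sqn (x - p) - xlast x ^+ 2) <= c ^+ 2 / 16.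
    have : 4 * (- A) ^+ 2 * (sqn (x - p) - xlast x ^+ 2) <= 4 * (- A) ^+ 2 * (r / 4) ^+ 2.
      have n0 : 0 <= 4 * (- A) ^+ 2 by apply: mulr_ge0 => //; exact: sqr_ge0.
      rewrite ler_wpM2l//.
      by have := sqr_ge0 (xlast x); move: Kx; rewrite /cball/=; lra.
    have -> : 4 * (- A) ^+ 2 * (r / 4) ^+ 2 = (A * r) ^+ 2 / 4 by field.
    rewrite Ar; have : A0 ^+ 2 <= (c / 2) ^+ 2 by rewrite ler_pXn2r// nnegrE; lra.
    by rewrite expr_div_n; lra.
  have t3 : (1 + 2 * (- C - - A) * xlast x) ^+ 2 <= 1.
    have -> : 1 + 2 * (- C - - A) * xlast x = 1 - 2 * d * A * xlast x by rewrite CE; ring.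
    by rewrite expr_le1//; lra.
  apply: (@le_lt_trans _ _ (b ^+ 2 * (1 + c ^+ 2 / 16))).
    by rewrite ler_wpM2l ?sqr_ge0//; lra.
  rewrite bE exprMn -mulrA -[ltRHS]mulr1 ltr_pM2l ?exprn_gt0//; nra.
have rr : 0 <= A0 / 32 * r by rewrite mulr_ge0 ?divr_ge0 ?ltW.
have rhoK : cball p (r / 4) y.
  have h : A0 / 32 * r <= r / 4 by rewrite mulrC ler_pM2l//; lra.
  by apply: le_trans yp _; rewrite ler_pXn2r// nnegrE; lra.
have := cmp y rhoK yc; apply/negP; rewrite -ltNge.
apply: lt_le_trans (Ku y rhoK).2.
rewrite /qtest pmulr_rlt0//.
have /andP[_ yr] := cball_xlast p0 rr yp.
have h1 : 0 <= C * xlast y ^+ 2 by rewrite mulr_ge0 ?sqr_ge0// ltW.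
have h2 : A * sqn (y - p) <= A * (A0 / 32 * r) ^+ 2 by rewrite ler_pM2l.
have h3 : A * (A0 / 32 * r) ^+ 2 = A0 ^+ 2 / 1024 * (A * r) * r by field.
have h4 : A0 ^+ 2 / 1024 * A0 * r <= A0 * r / 1024.
  have : A0 ^+ 2 <= 1 by rewrite expr_le1 ?ltW//; lra.
  by have : 0 < A0 * r by [exact: mulr_gt0|]; nra.
have h5 : 0 < A0 * r by exact: mulr_gt0.
by rewrite h3 Ar in h2; rewrite sigE mulNr opprK mulNr; lra.
Qed.

(** The lower barrier has slope [1 + c / 2], between 1 and a, and is subharmonic with gradient above
    1. On the sphere it is below a x_d where x_d >= 0 and nonpositive elsewhere, so u dominates it
    inside; at p its value is of order r. *)
Lemma slope_le_growth (c L : R) : 0 < c <= 1 -> 1 <= L ->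
  exists rho e : R, [/\ 0 < rho <= 4^-1, 0 < e & forall (r a : R) p V u,
    0 < r -> xlast p = 0 -> 1 + c <= a <= L ->
    slope_le 1 V u -> cball p (r / 4) `<=` V ->
    (forall x, cball p (r / 4) x -> [/\ {for x, continuous u}, 0 <= u x & a * xlast x <= u x]) ->
    forall y, cball p (rho * r) y -> 0 <= xlast y -> a * xlast y + e * r <= u y].
Proof.
move=> /andP[c0 c1] L1.
have d0 : 1 <= d by rewrite ler1n.
have [A0 A0E] : exists A0, A0 = c / (d + 1) / 4 by eexists.
have A0p : 0 < A0 by rewrite A0E !divr_gt0//; lra.
have dA0 : (d + 1) * A0 = c / 4 by rewrite A0E; field; lra.
have A0c : A0 <= c / 8 by move: dA0; nra.
(* Near p the barrier is at least 3 A0 r / 64, and this radius keeps a x_d <= L rho r = A0 r / 64;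
   the difference is A0 r / 32. *)
exists (A0 / (64 * L)), (A0 / 32); split.
- apply/andP; split; first by rewrite divr_gt0//; lra.
  by rewrite ler_pdivrMr; lra.
- by rewrite divr_gt0.
move=> r a p V u r0 p0 /andP[ca aL] su KV Ku y yp y0.
have r4 : 0 < r / 4 by rewrite divr_gt0.
have [A AE] : exists A, A = A0 / r by eexists.
have [C CE] : exists C, C = (d + 1) * A by eexists.
have [b bE] : exists b, b = 1 + c / 2 by eexists.
have [sig sigE] : exists sig, sig = A0 * r / 16 by eexists.
have b0 : 0 < b by rewrite bE; lra.
have A1 : 0 < A by rewrite AE divr_gt0.
have Ar : A * r = A0 by rewrite AE divfK// gt_eqF.
have C0 : 0 < C by rewrite CE mulr_gt0//; lra.
have Cr : C * r = c / 4 by rewrite CE -mulrA Ar.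
have lap x : 0 < laplacian (qtest b sig A C p) x.
  rewrite laplacian_qtest.
  have -> : 2 * b * (C - d * A) = 2 * b * A by rewrite CE; ring.
  by rewrite !mulr_gt0.
have cmp x : cball p (r / 4) x -> qtest b sig A C p x <= u x.
  apply: (slope_le_comparison (s := 1) (V := V)) => //.
  - by rewrite gt_eqF.
  - exact: cball_compact.
  - by move=> {}x /Ku[].
  move=> {}x Kx; have [_ u0 ux] := Ku x Kx.
  have /andP[xl xr] := cball_xlast p0 (ltW r4) Kx.
  have Cx1 : C * xlast x <= c / 16.
    have : C * xlast x <= C * (r / 4) by rewrite ler_pM2l.
    by rewrite mulrA Cr; lra.
  have Cx2 : - (c / 16) <= C * xlast x.
    have : C * - (r / 4) <= C * xlast x by rewrite ler_pM2l.
    by rewrite mulrN mulrA Cr; lra.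
  have [Ex|xlt] := eqVneq (sqn (x - p)) ((r / 4) ^+ 2).
    left.
    have -> : qtest b sig A C p x = b * (1 + C * xlast x) * xlast x.
      by rewrite /qtest Ex sigE -Ar; field.
    have [x0|x0] := lerP 0 (xlast x).
      by apply: le_trans ux; rewrite ler_wpM2r// bE; nra.
    apply: le_trans u0; rewrite mulr_ge0_le0 ?mulr_ge0 ?ltW//; lra.
  right; split => //; first exact: KV.
    by apply: cball_nbhs; rewrite lt_neqAle xlt.
  apply: lt_le_trans (enorm_grad_qtest_ge b sig A C x p0).
  have -> : 2 * (C - A) * xlast x = 2 * (C * xlast x) - 2 * (A * xlast x) by ring.
  have Ax : A * xlast x <= c / 32.
    have : A * xlast x <= A * (r / 4) by rewrite ler_pM2l.
    by rewrite mulrA Ar; lra.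
  by rewrite bE; nra.
have L0 : 0 < 64 * L by lra.
have rr : 0 <= A0 / (64 * L) * r by rewrite mulr_ge0 ?divr_ge0 ?ltW.
have rhoK : cball p (r / 4) y.
  have h : A0 / (64 * L) * r <= r / 4 by rewrite mulrC ler_pM2l//; rewrite ler_pdivrMr//; lra.
  by apply: le_trans yp _; rewrite ler_pXn2r// nnegrE; lra.
apply: le_trans (cmp y rhoK).
have /andP[_ yr] := cball_xlast p0 rr yp.
have h1 : 0 <= C * xlast y ^+ 2 by rewrite mulr_ge0 ?sqr_ge0// ltW.
have h2 : A * sqn (y - p) <= A * (A0 / (64 * L) * r) ^+ 2 by rewrite ler_pM2l.
have h3 : A * (A0 / (64 * L) * r) ^+ 2 = (A0 / (64 * L)) ^+ 2 * (A * r) * r by field; lra.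
have h5 : 0 < A0 * r by exact: mulr_gt0.
have h4 : (A0 / (64 * L)) ^+ 2 * A0 * r <= A0 * r / 64.
  have q : A0 / (64 * L) <= 1 / 8 by rewrite ler_pdivrMr//; lra.
  have : (A0 / (64 * L)) ^+ 2 <= (1 / 8) ^+ 2.
    by rewrite ler_pXn2r// nnegrE ?divr_ge0// ltW.
  have -> : (1 / 8 : R) ^+ 2 = 1 / 64 by field.
  by rewrite -mulrA => /(ler_wpM2r (ltW h5)); lra.
have h6 : a * xlast y <= A0 * r / 64.
  apply: (@le_trans _ _ (L * (A0 / (64 * L) * r))).
    by apply: ler_pM => //; lra.
  by rewrite le_eqVlt; apply/orP; left; apply/eqP; field; lra.
rewrite h3 Ar in h2.
have h7 : A0 * r / 16 - A0 * r / 64 <= xlast y + sig - A * sqn (y - p) + C * xlast y ^+ 2.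
  by rewrite sigE; lra.
apply: (@le_trans _ _ (1 * (A0 * r / 16 - A0 * r / 64))); first by lra.
rewrite /qtest; apply: ler_pM => //; rewrite ?bE; lra.
Qed.

End flat_point_barriers.

Section improvement.
Context {R : realType} {n : nat}.
Implicit Types (x y z p : 'rV[R]_n.+2) (V : set 'rV[R]_n.+2) (u w : 'rV[R]_n.+2 -> R).

(** Since the dimension is at least 2, [ord0] differs from [ord_max] and the point lies on {x_d =
    0}; its ball of radius r/4 keeps distance r/4 from 0. *)
Definition flat_point (r : R) : 'rV[R]_n.+2 := (r / 2) *: delta_mx 0 ord0.

Lemma xlast_flat_point (r : R) : xlast (flat_point r) = 0.
Proof. by rewrite /xlast !mxE eqxx/= mulr0. Qed.

Lemma sqn_Zdelta (m : nat) (t : R) (i : 'I_m) : sqn (t *: delta_mx 0 i : 'rV[R]_m) = t ^+ 2.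
Proof.
rewrite /sqn (bigD1 i)//= big1 ?addr0; first by rewrite !mxE !eqxx mulr1.
by move=> j /negbTE ji; rewrite !mxE ji andbF mulr0 expr0n.
Qed.

Lemma cball_flat_point (r : R) x : 0 < r -> cball (flat_point r) (r / 4) x ->
  (r / 4) ^+ 2 <= sqn x <= r ^+ 2.
Proof.
move=> r0 xp; apply/andP; split; last first.
  apply: le_trans (sqn_le_split2 x (flat_point r)) _.
  move: xp; rewrite /cball/= /flat_point sqn_Zdelta !expr_div_n.
  by have := sqr_ge0 r; lra.
apply: le_trans (coord_sqr_le_sqn x ord0).
have := le_trans (coord_sqr_le_sqn _ ord0) xp; rewrite !mxE !eqxx mulr1.
rewrite -[X in X <= _]real_normK ?num_real// ler_pXn2r ?nnegrE//; last by lra.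
rewrite ler_norml => /andP[h _]; rewrite ler_pXn2r ?nnegrE//; lra.
Qed.

Lemma cball_flat_point_annulus (r r0 : R) : 0 < r < 1 -> 0 <= r0 < r / 4 ->
  cball (flat_point r) (r / 4) `<=` eball 1 `\` closure (eball r0).
Proof.
move=> /andP[rp r1] /andP[r00 r0r] x /(cball_flat_point rp)/andP[xl xr]; split.
  by rewrite /eball/= enorm_lt// expr1n (le_lt_trans xr)// expr_lt1// ltW.
move=> /(closure_eball r00) h; have := le_trans xl h.
by rewrite ler_pXn2r ?nnegrE//; lra.
Qed.

(** The centre for [half_ball_growth] is placed at height rho r / 2 above the flat point. Its ball
    of radius rho r / 4 stays at height at least rho r / 4 and within rho r of the flat point, where
    the gain is assumed. *)
Lemma flat_point_growth (rho : R) : 0 < rho <= 4^-1 ->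
  exists2 theta : R, 0 < theta & forall (r e : R) w, 0 < r -> 0 < e ->
    (forall x, half_ball r x -> {for x, continuous w}) ->
    (forall x, half_ball r x -> 0 <= w x) ->
    (forall x, sqn x < r ^+ 2 -> 0 < xlast x -> weakly_superharmonic w x) ->
    (forall y, cball (flat_point r) (rho * r) y -> rho / 4 * r <= xlast y -> e * r <= w y) ->
    forall x, half_ball (r / 2) x -> theta * e * xlast x <= w x.
Proof.
move=> /andP[rho0 rho1]; have rho4 : 0 < rho / 4 by rewrite divr_gt0.
have [theta theta0 H] := @half_ball_growth R n.+1 (rho / 4) rho4.
exists theta => // r e w r0 e0 cw w0 sw wy x xH.
pose z := flat_point r + (rho / 2 * r) *: delta_mx 0 ord_max.
have zl : xlast z = rho / 2 * r
  by rewrite /xlast coord_addZdelta eqxx mul1r -/(xlast _) xlast_flat_point add0r.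
have er : 0 < e * r by rewrite mulr_gt0.
have := H r (e * r) z w r0 er; rewrite mulfK ?gt_eqF//; apply => //.
- by rewrite zl mulr_gt0// divr_gt0.
- rewrite sqn_addZdelta /flat_point sqn_Zdelta.
  rewrite -[X in _ * X * _]/(xlast (flat_point r)) xlast_flat_point.
  have -> : (r / 2) ^+ 2 + 2 * 0 * (rho / 2 * r) + (rho / 2 * r) ^+ 2 = (1 + rho ^+ 2) / 4 * r ^+ 2.
    by field.
  rewrite exprMn ler_pM2r ?exprn_gt0// expr_div_n.
  by have : rho ^+ 2 <= 1 by [rewrite expr_le1 ?ltW//; lra|]; lra.
- move=> y _ yz; apply: wy.
    rewrite /cball/=.
    have -> : y - flat_point r = (y - z) - (- ((rho / 2 * r) *: delta_mx 0 ord_max)).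
      by rewrite opprK /z opprD addrA subrK.
    apply: le_trans (sqn_sub_le _ _) _; rewrite -scaleNr sqn_Zdelta.
    have -> : 2 * (- (rho / 2 * r)) ^+ 2 = (rho * r) ^+ 2 / 2 by field.
    have : (rho / 4 * r) ^+ 2 = (rho * r) ^+ 2 / 16 by field.
    by have := sqr_ge0 (rho * r); move: yz; lra.
  have := le_trans (coord_sqr_le_sqn _ ord_max) yz; rewrite !mxE -/(xlast _).
  rewrite -[X in X <= _]real_normK ?num_real// ler_pXn2r ?nnegrE//; last by rewrite mulr_ge0 ?ltW.
  rewrite ler_norml => /andP[h _]; move: h zl; rewrite /xlast !mxE => h zl.
  by move: h; rewrite zl; lra.
Qed.

Section with_u.
Variables (L : R) (u : 'rV[R]_n.+2 -> R).
Hypotheses (L1 : 1 <= L) (uL : admissible L u).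

Lemma half_ball_eball (r : R) x : 0 <= r < 1 -> half_ball r x -> eball 1 x.
Proof.
move=> /andP[r0 r1] [xr _]; rewrite /eball/= enorm_lt// expr1n.
by apply: le_lt_trans xr _; rewrite expr_lt1.
Qed.

Lemma admissible_sub_continuous (a : R) x : eball 1 x ->
  {for x, continuous (fun y => u y - a * xlast y)}.
Proof.
move=> Bx; have c1 : {for x, continuous (@xlast R n.+1)} by exact: coord_continuous.
exact: continuousB (admissible_continuous uL Bx) (continuousM (@cst_continuous _ _ a x) c1).
Qed.

Lemma admissible_rsub_continuous (a : R) x : eball 1 x ->
  {for x, continuous (fun y => a * xlast y - u y)}.
Proof.
move=> Bx; have c1 : {for x, continuous (@xlast R n.+1)} by exact: coord_continuous.
exact: continuousB (continuousM (@cst_continuous _ _ a x) c1) (admissible_continuous uL Bx).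
Qed.

Lemma admissible_sub_superharmonic (a : R) x : posset (eball 1) u x ->
  weakly_superharmonic (fun y => u y - a * xlast y) x.
Proof.
move=> Px; apply: (@weakly_superharmonic_of_derive2 _ _ _ _
  (fun i => partial i (partial i u) x - 0)).
  move=> i; apply: derive2_alongB; first exact: admissible_derive2 uL Px.
  exact: derive2_along_coord.
under eq_bigr do rewrite subr0.
by have := admissible_laplacian uL Px; rewrite /laplacian => ->.
Qed.

(** At a zero of u the function lies below the harmonic a x_d and agrees with it, so no regularity
    of the free boundary enters. *)
Lemma admissible_rsub_superharmonic (a : R) x : eball 1 x ->
  weakly_superharmonic (fun y => a * xlast y - u y) x.
Proof.
move=> Bx; have [ux|ux] := ltrP 0 (u x).
  have Px : posset (eball 1) u x by [].
  apply: (@weakly_superharmonic_of_derive2 _ _ _ _ (fun i => 0 - partial i (partial i u) x)).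
    move=> i; apply: derive2_alongB; last exact: admissible_derive2 uL Px.
    exact: derive2_along_coord.
  under eq_bigr do rewrite sub0r.
  by rewrite sumrN; have := admissible_laplacian uL Px; rewrite /laplacian => ->; rewrite oppr0.
have u0 : u x = 0 by apply/eqP; rewrite eq_le ux (admissible_ge0 uL).
apply: (@weakly_superharmonic_touch _ _ _ (fun y => a * xlast y)).
- by rewrite u0 subr0.
- have := open_nbhs_nbhs (conj (@eball_open R n.+2 1) Bx).
  by apply: filterS => y By; rewrite gerBl (admissible_ge0 uL).
apply: (@weakly_superharmonic_of_derive2 _ _ _ _ (fun=> 0)); last by rewrite big1.
by move=> i; exact: derive2_along_coord.
Qed.

(** Evaluate at r e_d: [axis_lipschitz] and u(0) = 0 give u(r e_d) <= L r. *)
Lemma le_slope_of_half_space (r a : R) : 0 < r < 1 ->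
  (forall x, half_ball r x -> a * xlast x <= u x) -> a <= L.
Proof.
move=> /andP[r0 r1] ha; pose x : 'rV[R]_n.+2 := 0 + r *: delta_mx 0 ord_max.
have seg (s : R) : 0 <= s <= 1 -> eball 1 (0 + (s * r) *: delta_mx 0 ord_max : 'rV[R]_n.+2).
  move=> /andP[s0 s1]; have sr : 0 <= s * r by rewrite mulr_ge0// ltW.
  rewrite /eball/= enorm_lt// add0r sqn_Zdelta expr1n expr_lt1//.
  by apply: le_lt_trans r1; rewrite ger_pMl.
have xl : xlast x = r by rewrite /xlast coord_addZdelta eqxx mul1r mxE add0r.
have xH : half_ball r x.
  by split; [rewrite /x add0r sqn_Zdelta|rewrite xl ltW].
have L0 : 0 <= L by apply: le_trans L1.
have := axis_lipschitz L0 uL seg; rewrite (admissible_at0 uL) subr0 (gtr0_norm r0) => h.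
have := le_trans (ha x xH) (le_trans (ler_norm _) h).
by rewrite xl ler_pM2r.
Qed.

End with_u.

(** The point z may lie on {x_d = 0}, so the centre is raised by eta/2. The ratio [eta * 2 / 7]
    times the radius 7/8 is eta/4, which keeps the new ball inside the given one. *)
Lemma initial_growth (eta : R) : 0 < eta <= 32^-1 ->
  exists2 theta : R, 0 < theta & forall (e : R) z w, 0 < e ->
    (forall x, half_ball (7 / 8) x -> {for x, continuous w}) ->
    (forall x, half_ball (7 / 8) x -> 0 <= w x) ->
    (forall x, sqn x < (7 / 8) ^+ 2 -> 0 < xlast x -> weakly_superharmonic w x) ->
    sqn z <= (3 / 4) ^+ 2 -> 0 <= xlast z ->
    (forall y, sqn (y - z) <= eta ^+ 2 -> e <= w y) ->
    forall x, half_ball (7 / 16) x -> theta * e * xlast x <= w x.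
Proof.
move=> /andP[eta0 eta1]; have rho0 : 0 < eta * 2 / 7 by rewrite divr_gt0// mulr_gt0.
have [theta theta0 H] := @half_ball_growth R n.+1 (eta * 2 / 7) rho0.
exists (theta * (8 / 7)); first by rewrite mulr_gt0// divr_gt0.
move=> e z w e0 cw w0 sw z34 z0 wz x xH.
pose z' := z + (eta / 2) *: delta_mx 0 ord_max.
have z'l : xlast z' = xlast z + eta / 2 by rewrite /xlast coord_addZdelta eqxx mul1r.
have zl1 : xlast z <= 1.
  have := le_trans (coord_sqr_le_sqn z ord_max) z34; rewrite -/(xlast _) => h.
  by have := sqr_ge0 (xlast z - 1); move: h; rewrite expr_div_n; nra.
have r0 : 0 < 7 / 8 :> R by rewrite divr_gt0.
have -> : theta * (8 / 7) * e * xlast x = theta * (e / (7 / 8)) * xlast x by field.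
apply: (H (7 / 8) e z' w) => //.
- by rewrite z'l ltr_wpDl// divr_gt0.
- rewrite sqn_addZdelta -/(xlast z).
  have h1 : xlast z * eta <= eta by rewrite ger_pMl.
  have h2 : eta ^+ 2 <= eta by rewrite expr2 ger_pMl//; lra.
  have -> : (eta / 2) ^+ 2 = eta ^+ 2 / 4 by field.
  have -> : 2 * xlast z * (eta / 2) = xlast z * eta by field.
  have -> : (15 / 16 * (7 / 8) : R) ^+ 2 = 11025 / 16384 by field.
  by move: z34; rewrite expr_div_n; lra.
- move=> y _ yz; apply: wz.
  have -> : y - z = (y - z') - (- ((eta / 2) *: delta_mx 0 ord_max)).
    by rewrite opprK /z' opprD addrA subrK.
  apply: le_trans (sqn_sub_le _ _) _; rewrite -scaleNr sqn_Zdelta.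
  have -> : 2 * (- (eta / 2)) ^+ 2 = eta ^+ 2 / 2 by field.
  have : (eta * 2 / 7 * (7 / 8)) ^+ 2 = eta ^+ 2 / 16 by field.
  by have := sqr_ge0 eta; move: yz; lra.
- by move: xH; have -> : (7 / 16 : R) = 7 / 8 / 2 by field.
Qed.

End improvement.

(** * Iteration over dyadic half balls *)

Section iteration.
Context {R : realType} {n : nat}.
Implicit Types (x y z p : 'rV[R]_n.+2) (u : 'rV[R]_n.+2 -> R).

Lemma half_ball_flat_point (r : R) x : 0 < r -> cball (flat_point r) (r / 4) x ->
  0 <= xlast x -> half_ball r x.
Proof. by move=> r0 /(cball_flat_point r0)/andP[_ xr] x0. Qed.

Lemma half_ballS (r s : R) x : 0 <= r <= s -> half_ball r x -> half_ball s x.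
Proof.
move=> /andP[r0 rs] [xr x0]; split => //; apply: le_trans xr _.
by rewrite ler_pXn2r ?nnegrE// (le_trans r0).
Qed.

Lemma closure_posset_half_space V u : (forall x, V x -> u x <= pospart (xlast x)) ->
  forall x, closure (posset V u) x -> 0 <= xlast x.
Proof.
move=> ux x; rewrite closureE => H.
apply: (H [set x | 0 <= xlast x]); split.
  apply: (@closed_comp _ _ (@xlast R n.+1) [set y | 0 <= y]); last exact: closed_ge.
  by move=> y _; exact: xlast_continuous.
move=> y [Vy uy] /=; have := lt_le_trans uy (ux y Vy).
by rewrite /pospart lt_max ltxx orbF => /ltW.
Qed.

(** Near the flat point u vanishes by [slope_ge_vanishing], so a x_d - u equals a x_d, which is at
    least l rho r / 4 at height rho r / 4. The bound [l <= a] is what makes [gam] uniform in a. *)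
Lemma decrease_step (c l : R) : 0 < c <= 1 -> 0 < l ->
  exists2 gam : R, 0 < gam & forall (L r r0 a : R) u, admissible L u ->
    (forall x, eball 1 x -> u x <= pospart (xlast x)) ->
    0 < r < 1 -> 0 <= r0 < r / 4 ->
    slope_ge 1 (eball 1 `\` closure (eball r0)) u -> l <= a <= 1 - c ->
    (forall x, half_ball r x -> u x <= a * xlast x) ->
    forall x, half_ball (r / 2) x -> u x <= (a - gam) * xlast x.
Proof.
move=> c01 l0; have [rho rho01 van] := @slope_ge_vanishing R n.+1 c c01.
have [theta theta0 grow] := @flat_point_growth R n rho rho01.
have /andP[rho0 rho1] := rho01.
have e0 : 0 < l * (rho / 4) by rewrite !mulr_gt0// invr_gt0.
exists (theta * (l * (rho / 4))); first exact: mulr_gt0.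
move=> L r r0 a u uL ux r01 r0r su /andP[la ac] ua x xH.
have /andP[rp r1] := r01.
have KV := @cball_flat_point_annulus R n r r0 r01 r0r.
have KB y : cball (flat_point r) (r / 4) y -> eball 1 y by move=> /KV[].
have HB y : half_ball r y -> eball 1 y by apply: half_ball_eball; rewrite ltW.
rewrite mulrBl lerBrDr -lerBrDl.
apply: (grow r (l * (rho / 4)) (fun y => a * xlast y - u y)) => //.
- by move=> y /HB By; exact: (admissible_rsub_continuous uL By).
- by move=> y /ua; rewrite subr_ge0.
- by move=> y yr y0; apply: (admissible_rsub_superharmonic uL); apply: HB; split; exact: ltW.
move=> y yp yl.
have yK : cball (flat_point r) (r / 4) y.
  have h : rho * r <= r / 4 by rewrite mulrC ler_pM2l.
  have h' : 0 <= rho * r by rewrite mulr_ge0// ltW.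
  by apply: le_trans yp _; rewrite ler_pXn2r// nnegrE; lra.
have yc : ~ closure (posset (eball 1 `\` closure (eball r0)) u) y.
  apply: (van 1 r a (flat_point r)) (yp) => //.
  - exact: xlast_flat_point.
  - by rewrite mul1r.
  - by move=> z /KB Bz; split; [exact: (admissible_continuous uL Bz)|exact: (admissible_ge0 uL)].
  - move=> z zK zc.
    have z0 : 0 <= xlast z.
      by apply: closure_posset_half_space zc => z' [Bz' _]; exact: ux.
    by split => //; apply: ua; exact: half_ball_flat_point zK z0.
have uy : u y <= 0.
  rewrite leNgt; apply/negP => uy; apply: yc; apply: subset_closure.
  by split => //; exact: KV.
have h1 : l * (rho / 4 * r) <= a * xlast y.
  by apply: ler_pM => //; rewrite ?ltW// !mulr_gt0// invr_gt0.
by rewrite -mulrA; lra.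
Qed.

(** The bound a <= L needed by [slope_le_growth] comes for free from [le_slope_of_half_space], so
    [gam] depends only on c and L besides the dimension. *)
Lemma increase_step (c L : R) : 0 < c <= 1 -> 1 <= L ->
  exists2 gam : R, 0 < gam & forall (r r0 a : R) u, admissible L u ->
    (forall x, eball 1 x -> pospart (xlast x) <= u x) ->
    0 < r < 1 -> 0 <= r0 < r / 4 ->
    slope_le 1 (eball 1 `\` closure (eball r0)) u -> 1 + c <= a ->
    (forall x, half_ball r x -> a * xlast x <= u x) ->
    forall x, half_ball (r / 2) x -> (a + gam) * xlast x <= u x.
Proof.
move=> c01 L1; have [rho [e [rho01 e0 bar]]] := @slope_le_growth R n.+1 c L c01 L1.
have [theta theta0 grow] := @flat_point_growth R n rho rho01.
have /andP[rho0 rho1] := rho01.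
exists (theta * e); first exact: mulr_gt0.
move=> r r0 a u uL ux r01 r0r su ca ua x xH.
have /andP[rp r1] := r01.
have aL := le_slope_of_half_space L1 uL r01 ua.
have a0 : 0 <= a by case/andP: c01; lra.
have KV := @cball_flat_point_annulus R n r r0 r01 r0r.
have KB y : cball (flat_point r) (r / 4) y -> eball 1 y by move=> /KV[].
have HB y : half_ball r y -> eball 1 y by apply: half_ball_eball; rewrite ltW.
rewrite mulrDl addrC -lerBrDr.
apply: (grow r e (fun y => u y - a * xlast y)) => //.
- by move=> y /HB By; exact: (admissible_sub_continuous uL By).
- by move=> y /ua; rewrite subr_ge0.
- move=> y yr y0; have By : eball 1 y by apply: HB; split; exact: ltW.
  apply: (admissible_sub_superharmonic uL); split => //.
  by apply: lt_le_trans (ux y By); rewrite /pospart lt_max y0.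
move=> y yp yl; rewrite lerBrDl.
have y0 : 0 <= xlast y by apply: le_trans yl; rewrite !mulr_ge0 ?invr_ge0// ltW.
apply: (bar r a (flat_point r) (eball 1 `\` closure (eball r0)) u _ _ _ _ _ _ y yp y0) => //.
- exact: xlast_flat_point.
- by rewrite ca aL.
- move=> z zK; have Bz := KB z zK.
  split; [exact: (admissible_continuous uL Bz)|exact: (admissible_ge0 uL)|].
  have [z0|z0] := lerP 0 (xlast z); first by apply: ua; exact: half_ball_flat_point zK z0.
  by apply: le_trans (admissible_ge0 uL Bz); rewrite mulr_ge0_le0// ltW.
Qed.

Lemma half_pow_div2 (k : nat) : 7 / 16 / 2 ^+ k.+1 = 7 / 16 / 2 ^+ k / 2 :> R.
Proof. by rewrite exprS invfM mulrA mulrAC. Qed.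

Lemma half_pow_itv (k : nat) : 0 < (7 : R) / 16 / 2 ^+ k < 1.
Proof.
apply/andP; split; first by rewrite !divr_gt0// exprn_gt0.
rewrite ltr_pdivrMr ?exprn_gt0// mul1r.
by apply: (@lt_le_trans _ _ 1); [lra|apply: exprn_ege1; lra].
Qed.

(** The condition with slope l holds across B_{r0} too, so the final vanishing barrier may be
    centred at the free boundary point 0 itself. *)
Lemma no_slope_decrease (c l : R) : 0 < c <= 1 -> 0 < l ->
  exists2 r0 : R, 0 < r0 & forall (L : R) u, admissible L u ->
    (forall x, eball 1 x -> u x <= pospart (xlast x)) ->
    slope_ge l (eball 1) u ->
    slope_ge 1 (eball 1 `\` closure (eball r0)) u ->
    ~ (forall x, half_ball (7 / 16) x -> u x <= (1 - c) * xlast x).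
Proof.
move=> c01 l0; have l20 : 0 < l / 2 by rewrite divr_gt0.
have [gam gam0 step] := decrease_step c01 l20.
have h01 : 0 < (2 : R)^-1 <= 1 by apply/andP; split; lra.
have [rho /andP[rho0 _] van] := @slope_ge_vanishing R n.+1 2^-1 h01.
pose N := Num.bound gam^-1.
have gN : 1 <= N%:R * gam.
  by rewrite -ler_pdivrMr// mul1r ltW// archi_boundP// invr_ge0 ltW.
pose r0 : R := 7 / 16 / 2 ^+ N / 8.
have /andP[rN0 rN1] := half_pow_itv N.
have r00 : 0 < r0 by rewrite divr_gt0.
exists r0 => // L u uL ux sl s1 init.
(* Once a is at most l/2 it is carried along unchanged, since [decrease_step] needs a lower bound on
   a. Otherwise it has lost [gam] at each step, and after N steps it would be negative because N gam
   >= 1. *)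
have iter k : (k <= N)%N -> exists a, [/\ a <= 1 - c, a <= l / 2 \/ a <= 1 - c - k%:R * gam &
    forall x, half_ball (7 / 16 / 2 ^+ k) x -> u x <= a * xlast x].
  elim: k => [_|k IH kN].
    exists (1 - c); split => //; first by right; rewrite mul0r subr0.
    by rewrite expr0 divr1.
  have /andP[rk0 rk1] := half_pow_itv k.
  have [a [ac alt ua]] := IH (ltnW kN); rewrite half_pow_div2.
  have [al|al] := lerP a (l / 2).
    exists a; split => //; first by left.
    by move=> x xH; apply: ua; apply: half_ballS xH; apply/andP; split; lra.
  exists (a - gam); split; first lra.
    right; case: alt => [|h]; first by rewrite leNgt al.
    by rewrite -natr1 mulrDl mul1r; lra.
  apply: (step L _ r0) => //; first by rewrite rk0.
    rewrite ltW//=.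
    have : 7 / 16 / 2 ^+ N <= 7 / 16 / 2 ^+ k :> R.
      rewrite ler_pM2l ?divr_gt0// lef_pV2 ?posrE ?exprn_gt0//.
      by apply: ler_weXn2l; [lra|exact: ltnW].
    by rewrite /r0; move: rN0; lra.
  by rewrite ltW.
have [a [_ alt ua]] := iter N (leqnn N).
have al : a <= l / 2 by case: alt => //; case/andP: c01; lra.
set r := 7 / 16 / 2 ^+ N in rN0 rN1 ua.
have x00 : xlast (0 : 'rV[R]_n.+2) = 0 by rewrite /xlast mxE.
have KB y : cball 0 (r / 4) y -> sqn y < r ^+ 2.
  rewrite /cball/= subr0 => h; apply: le_lt_trans h _.
  by rewrite ltr_pXn2r ?nnegrE ?divr_ge0 ?ltW//; lra.
have KB1 y : cball 0 (r / 4) y -> eball 1 y.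
  move=> /KB h; rewrite /eball/= enorm_lt// expr1n (lt_trans h)//.
  by rewrite expr_lt1 ?ltW.
have z0 : cball 0 (rho * r) (0 : 'rV[R]_n.+2).
  rewrite /cball/= subr0 /sqn big1 ?sqr_ge0// => i _.
  by rewrite mxE expr0n.
(* Here [van] has c = 1/2, so its requirement is exactly a <= l/2. *)
apply: (van l r a 0 (eball 1) u _ _ _ _ sl _ _ _ 0 z0) => //.
- by lra.
- by move=> y /KB1 By; split; [exact: (admissible_continuous uL By)|exact: (admissible_ge0 uL)].
- move=> y yK yc; have y0 : 0 <= xlast y by exact: closure_posset_half_space ux _ yc.
  by split => //; apply: ua; split => //; exact/ltW/KB.
by case: uL => _ _ _ _ [].
Qed.

(** Every smaller exceptional radius r1 is allowed, since part (i) takes the minimum of two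
    radii. *)
Lemma no_slope_increase (c L : R) : 0 < c <= 1 -> 1 <= L ->
  exists2 r0 : R, 0 < r0 & forall (r1 : R) u, 0 <= r1 <= r0 -> admissible L u ->
    (forall x, eball 1 x -> pospart (xlast x) <= u x) ->
    slope_le 1 (eball 1 `\` closure (eball r1)) u ->
    ~ (forall x, half_ball (7 / 16) x -> (1 + c) * xlast x <= u x).
Proof.
move=> c01 L1; have [gam gam0 step] := increase_step c01 L1.
have L0 : 0 <= L / gam by rewrite divr_ge0 ?ltW//; apply: lt_le_trans L1.
pose N := Num.bound (L / gam).
have gN : L < N%:R * gam by rewrite -ltr_pdivrMr// archi_boundP.
pose r0 : R := 7 / 16 / 2 ^+ N / 8.
have /andP[rN0 rN1] := half_pow_itv N.
have r00 : 0 < r0 by rewrite divr_gt0.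
exists r0 => // r1 u /andP[r10 r1r0] uL ux s1 init.
have iter k : (k <= N)%N ->
    forall x, half_ball (7 / 16 / 2 ^+ k) x -> (1 + c + k%:R * gam) * xlast x <= u x.
  elim: k => [_|k IH kN].
    by rewrite expr0 divr1 mul0r addr0.
  have /andP[rk0 rk1] := half_pow_itv k.
  have -> : 1 + c + k.+1%:R * gam = 1 + c + k%:R * gam + gam by rewrite -natr1; ring.
  rewrite half_pow_div2.
  apply: (step _ r1) => //; first by rewrite rk0.
  - rewrite r10/=.
    have : 7 / 16 / 2 ^+ N <= 7 / 16 / 2 ^+ k :> R.
      rewrite ler_pM2l ?divr_gt0// lef_pV2 ?posrE ?exprn_gt0//.
      by apply: ler_weXn2l; [lra|exact: ltnW].
    by move: r1r0; rewrite /r0; move: rN0; lra.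
  - by rewrite lerDl mulr_ge0 ?ler0n ?ltW.
  - exact: IH (ltnW kN).
have := le_slope_of_half_space L1 uL (half_pow_itv N) (iter N (leqnn N)).
by case/andP: c01; lra.
Qed.

End iteration.

(** * Pointwise bounds on the upper half space *)

Section half_space_bounds.
Context {R : realType} {n : nat}.
Implicit Types (x y z p : 'rV[R]_n.+2) (u : 'rV[R]_n.+2 -> R).
Local Notation d := (n.+2%:R : R).

Lemma eball_sqn (r : R) x : 0 <= r -> eball r x = (sqn x < r ^+ 2) :> Prop.
Proof. by move=> r0; rewrite /eball/= enorm_lt. Qed.

Lemma admissible_lipschitz (L eta : R) u z y : 1 <= L -> admissible L u ->
  0 <= eta <= 32^-1 -> sqn z <= (3 / 4) ^+ 2 -> sqn (y - z) <= eta ^+ 2 ->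
  `|u y - u z| <= d * L * eta.
Proof.
move=> L1 uL /andP[eta0 eta1] z34 yz.
apply: (ball_lipschitz (le_trans ler01 L1) uL) => // p pz.
rewrite eball_sqn// expr1n; apply: le_lt_trans (sqn_le_split p z) _.
have : eta ^+ 2 <= 32^-1 ^+ 2 by rewrite ler_pXn2r// nnegrE; lra.
have -> : (32^-1 : R) ^+ 2 = 1 / 1024 by field.
by move: z34; have -> : (3 / 4 : R) ^+ 2 = 9 / 16 by [field|]; lra.
Qed.

(** On a ball of radius eta, u varies from its central value by at most d L eta and x_d by at most
    eta, so u - x_d varies by at most e. *)
Lemma oscillation_radius (L e : R) : 1 <= L -> 0 < e ->
  exists2 eta : R, 0 < eta <= 32^-1 & (d * L + 1) * eta <= e.
Proof.
move=> L1 e0; have dL : 0 < d * L + 1 by rewrite addr_gt0// mulr_gt0//; lra.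
exists (Num.min 32^-1 (e / (d * L + 1))).
  by rewrite lt_min invr_gt0 ge_min lexx divr_gt0// ltr0n.
by rewrite mulrC -ler_pdivlMr// ge_min lexx orbT.
Qed.

Lemma xlast_sub_le y z (eta : R) : 0 <= eta -> sqn (y - z) <= eta ^+ 2 ->
  `|xlast y - xlast z| <= eta.
Proof.
move=> eta0 yz; have := coord_norm_le_enorm (y - z) ord_max.
by rewrite !mxE => h; apply: le_trans h _; rewrite enorm_le.
Qed.

Lemma upper_bound_on_half_space (L e : R) : 1 <= L -> 0 < e ->
  exists2 r0 : R, 0 < r0 & forall (r1 : R) u, 0 <= r1 <= r0 -> admissible L u ->
    (forall x, eball 1 x -> pospart (xlast x) <= u x) ->
    slope_le 1 (eball 1 `\` closure (eball r1)) u ->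
    forall z, sqn z <= (3 / 4) ^+ 2 -> 0 <= xlast z -> u z <= xlast z + e.
Proof.
move=> L1 e0; have e20 : 0 < e / 2 by rewrite divr_gt0.
have [eta eta01 etaE] := oscillation_radius L1 e20.
have /andP[eta0 eta1] := eta01.
have [theta theta0 init] := @initial_growth R n eta eta01.
(* Half of the excess e survives on the ball of radius eta; the cap at 1 meets the range of c in the
   barrier lemmas. *)
pose c := Num.min 1 (theta * (e / 2)).
have c01 : 0 < c <= 1 by rewrite lt_min ltr01 mulr_gt0//= ge_min lexx.
have [r0 r00 H] := @no_slope_increase R n c L c01 L1.
exists r0 => // r1 u r1r uL ux su z z34 z0; rewrite leNgt; apply/negP => uz.
have r78 : 0 <= (7 : R) / 8 < 1 by apply/andP; split; lra.
have HB y : half_ball (7 / 8) y -> eball 1 y by exact: half_ball_eball.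
apply: (H r1 u r1r uL ux su) => x xH.
have := init (e / 2) z (fun y => u y - 1 * xlast y) e20.
move=> /(_ _ _ _ z34 z0 _ x xH) h.
have x0 : 0 <= xlast x by case: xH.
have cx : c * xlast x <= theta * (e / 2) * xlast x.
  by rewrite ler_wpM2r// ge_min lexx orbT.
suff : theta * (e / 2) * xlast x <= u x - 1 * xlast x by rewrite mulrDl; lra.
apply: h.
- by move=> y /HB By; exact: (admissible_sub_continuous uL By).
- move=> y Hy; have := ux y (HB y Hy); rewrite /pospart ge_max mul1r subr_ge0.
  by case/andP.
- move=> y yr y0; have By : eball 1 y by apply: HB; split; exact: ltW.
  apply: (admissible_sub_superharmonic uL); split => //.
  by apply: lt_le_trans (ux y By); rewrite /pospart lt_max y0.
move=> y yz; have eta0' : 0 <= eta <= 32^-1 by rewrite ltW.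
have := admissible_lipschitz L1 uL eta0' z34 yz; have := xlast_sub_le (ltW eta0) yz.
by rewrite !ler_norml; move: etaE uz; rewrite mulrDl; lra.
Qed.

Lemma lower_bound_on_half_space (L e l : R) : 1 <= L -> 0 < e -> 0 < l ->
  exists2 r0 : R, 0 < r0 & forall u, admissible L u ->
    (forall x, eball 1 x -> u x <= pospart (xlast x)) ->
    slope_ge l (eball 1) u ->
    slope_ge 1 (eball 1 `\` closure (eball r0)) u ->
    forall z, sqn z <= (3 / 4) ^+ 2 -> 0 <= xlast z -> xlast z - e <= u z.
Proof.
move=> L1 e0 l0; have e20 : 0 < e / 2 by rewrite divr_gt0.
have [eta eta01 etaE] := oscillation_radius L1 e20.
have /andP[eta0 eta1] := eta01.
have [theta theta0 init] := @initial_growth R n eta eta01.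
pose c := Num.min 1 (theta * (e / 2)).
have c01 : 0 < c <= 1 by rewrite lt_min ltr01 mulr_gt0//= ge_min lexx.
have [r0 r00 H] := @no_slope_decrease R n c l c01 l0.
exists r0 => // u uL ux sl su z z34 z0; rewrite leNgt; apply/negP => uz.
have r78 : 0 <= (7 : R) / 8 < 1 by apply/andP; split; lra.
have HB y : half_ball (7 / 8) y -> eball 1 y by exact: half_ball_eball.
apply: (H L u uL ux sl su) => x xH.
have := init (e / 2) z (fun y => 1 * xlast y - u y) e20.
move=> /(_ _ _ _ z34 z0 _ x xH) h.
have x0 : 0 <= xlast x by case: xH.
have cx : c * xlast x <= theta * (e / 2) * xlast x.
  by rewrite ler_wpM2r// ge_min lexx orbT.
suff : theta * (e / 2) * xlast x <= 1 * xlast x - u x by rewrite mulrBl; lra.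
apply: h.
- by move=> y /HB By; exact: (admissible_rsub_continuous uL By).
- move=> y Hy; have := ux y (HB y Hy); rewrite /pospart le_max mul1r subr_ge0.
  by case: Hy => _ y0 /orP[//|h]; exact: le_trans h y0.
- move=> y yr y0; have By : eball 1 y by apply: HB; split; exact: ltW.
  exact: (admissible_rsub_superharmonic uL By).
move=> y yz; have eta0' : 0 <= eta <= 32^-1 by rewrite ltW.
have := admissible_lipschitz L1 uL eta0' z34 yz; have := xlast_sub_le (ltW eta0) yz.
by rewrite !ler_norml; move: etaE uz; rewrite mulrDl; lra.
Qed.

End half_space_bounds.

(** * Vanishing below the half space *)

Section below_half_space.
Context {R : realType} {n : nat}.
Implicit Types (x y z p : 'rV[R]_n.+2) (u : 'rV[R]_n.+2 -> R).
Local Notation d := (n.+2%:R : R).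

(** For p on {x_d = 0}, [sqn (x - p) - xlast x ^+ 2] is the squared horizontal distance to p: this
    is a cylinder of radius 1/8 and depth 1/4 hanging from {x_d = 0}. *)
Definition slab_cylinder p : set 'rV[R]_n.+2 :=
  [set x | [/\ - (1 / 4) <= xlast x, xlast x <= 0 & sqn (x - p) - xlast x ^+ 2 <= 1 / 64]].

Lemma radial_sqn_continuous p : continuous (fun x => sqn (x - p) - xlast x ^+ 2).
Proof.
move=> x; have c1 : {for x, continuous (@xlast R n.+1)} by exact: coord_continuous.
exact: continuousB (@sqnB_continuous _ _ p x) (continuousM c1 c1).
Qed.

Lemma slab_cylinder_sqn p x : slab_cylinder p x -> sqn (x - p) <= 5 / 64.
Proof.
move=> [x1 x2 xp].
have : xlast x ^+ 2 <= 1 / 16 by have := sqr_ge0 (xlast x); nra.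
by lra.
Qed.

Lemma slab_cylinder_compact p : compact (slab_cylinder p).
Proof.
apply: bounded_closed_compact.
  apply: (@sqn_le_bounded _ _ (2 * sqn p + 2 * (5 / 64))) => x /slab_cylinder_sqn h.
  by apply: le_trans (sqn_le_split2 x p) _; lra.
have -> : slab_cylinder p = (@xlast R n.+1) @^-1` [set y | - (1 / 4) <= y] `&`
    (@xlast R n.+1) @^-1` [set y | y <= 0] `&`
    (fun x => sqn (x - p) - xlast x ^+ 2) @^-1` [set y | y <= 1 / 64].
  by apply/seteqP; split => x /=; [case|case=> -[]].
apply: closedI; first apply: closedI.
- by apply: closed_comp => [x _|]; [exact: xlast_continuous|exact: closed_ge].
- by apply: closed_comp => [x _|]; [exact: xlast_continuous|exact: closed_le].
- by apply: closed_comp => [x _|]; [exact: radial_sqn_continuous|exact: closed_le].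
Qed.

Lemma slab_cylinder_nbhs p x : - (1 / 4) < xlast x -> xlast x < 0 ->
  sqn (x - p) - xlast x ^+ 2 < 1 / 64 -> nbhs x (slab_cylinder p).
Proof.
move=> x1 x2 xp.
have h1 : nbhs x [set y | - (1 / 4) < xlast y] by exact: (xlast_continuous (lt_nbhsr x1)).
have h2 : nbhs x [set y | xlast y < 0] by exact: (xlast_continuous (lt_nbhsl x2)).
have h3 : nbhs x [set y | sqn (y - p) - xlast y ^+ 2 < 1 / 64].
  exact: (radial_sqn_continuous (lt_nbhsl xp)).
by apply: filterS3 h1 h2 h3 => y /= y1 y2 y3; split; exact: ltW.
Qed.

Lemma closure_posset_xlast (V : set 'rV[R]_n.+2) u (eta : R) :
  (forall x, V x -> u x <= pospart (xlast x + eta)) ->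
  forall x, closure (posset V u) x -> - eta <= xlast x.
Proof.
move=> ux x; rewrite closureE => H.
apply: (H [set x | - eta <= xlast x]); split.
  apply: (@closed_comp _ _ (@xlast R n.+1) [set y | - eta <= y]); last exact: closed_ge.
  by move=> y _; exact: xlast_continuous.
move=> y [Vy uy] /=; have := lt_le_trans uy (ux y Vy).
by rewrite /pospart lt_max ltxx orbF; lra.
Qed.

(** The barrier is (l/3)(x_d + delta/2 + 4 |x' - p'|^2 - 4 d x_d^2), superharmonic with gradient
    below l in the relevant part of the slab. It dominates u on the top by the bound l delta / 6, on
    the side because u <= l / (72 d) there, and in the closed B_{r1} by the Lipschitz estimate; the
    closure of {u > 0} does not reach the bottom. *)
Lemma bound_below_half_space (L delta l : R) : 1 <= L -> 0 < delta -> 0 < l <= 1 ->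
  exists2 r0 : R, 0 < r0 & forall (r1 : R) u, 0 < r1 <= r0 -> admissible L u ->
    (forall x, eball 1 x -> u x <= pospart (xlast x + l / (72 * d))) ->
    slope_ge l (eball 1 `\` closure (eball r1)) u ->
    (forall z, sqn z <= (3 / 4) ^+ 2 -> 0 <= xlast z -> u z <= xlast z + l * delta / 6) ->
    forall x, eball 2^-1 x -> xlast x < 0 -> u x <= pospart (xlast x + delta).
Proof.
move=> L1 delta0 /andP[l0 l1].
have d2 : 2 <= d by rewrite ler_nat.
(* Since 8 d eta = l/9, the vertical factor of the gradient is at most 10/9; moreover eta stays
   below the lateral values of the barrier, about l/48. *)
have [eta etaE] : exists eta, eta = l / (72 * d) by eexists.
have etad : 72 * (d * eta) = l by rewrite etaE; field; lra.
have eta0 : 0 < eta by rewrite etaE divr_gt0// mulr_gt0//; lra.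
have etal : eta <= l / 144 by have : 0 <= (d - 2) * eta by [apply: mulr_ge0; lra|]; lra.
have [e eE] : exists e, e = l * delta / 6 by eexists.
have e0 : 0 < e by rewrite eE divr_gt0// mulr_gt0.
have ed : 6 * e <= delta by rewrite eE; have : l * delta <= delta by [rewrite ger_pMl|]; lra.
(* With [D * r1 <= e], the bound d L r1 for u in the closed B_{r1} stays under the barrier, which is
   at least e - r1 there. *)
have [D DE] : exists D, D = d * L + 1 + 4 * d by eexists.
have dL0 : 0 < d * L by rewrite mulr_gt0//; lra.
have D0 : 0 < D by rewrite DE; lra.
exists (Num.min 32^-1 (e / D)); first by rewrite lt_min invr_gt0 ltr0n divr_gt0.
move=> r1 u /andP[r10]; rewrite le_min => /andP[r132]; rewrite ler_pdivlMr// mulrC => rD.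
move=> uL; rewrite -etaE -eE => ux su uup x0 Bx0 x00.
have x0sq : sqn x0 < 1 / 4.
  by move: Bx0; rewrite eball_sqn ?invr_ge0// exprVn; lra.
have small x : sqn x <= r1 ^+ 2 -> u x <= d * L * r1 /\ - r1 <= xlast x.
  move=> xr; have r1' : 0 <= r1 <= 32^-1 by rewrite ltW.
  have z0 : sqn (0 : 'rV[R]_n.+2) <= (3 / 4) ^+ 2.
    by rewrite /sqn big1 ?sqr_ge0// => i _; rewrite mxE expr0n.
  have xr' : sqn (x - 0) <= r1 ^+ 2 by rewrite subr0.
  have := admissible_lipschitz L1 uL r1' z0 xr'; have := xlast_sub_le (ltW r10) xr'.
  by rewrite (admissible_at0 uL) /xlast mxE !subr0 !ler_norml; lra.
have pp (t : R) : t <= pospart t /\ 0 <= pospart t.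
  by rewrite /pospart !le_max !lexx orbT.
have [p1 p2] := pp (xlast x0 + delta).
have [ux0|ux0] := lerP (u x0) 0; first exact: le_trans p2.
have [x0r|x0r] := pselect (closure (eball r1) x0).
  have [] := small _ (closure_eball (ltW r10) x0r).
  have : 0 <= (L - 1) * (d * r1) by apply: mulr_ge0; [lra|apply: mulr_ge0; lra].
  by move: rD; rewrite DE; nra.
(* The projection of x0 to {x_d = 0}: the horizontal term of the barrier vanishes at x0. *)
pose p : 'rV[R]_n.+2 := x0 + (- xlast x0) *: delta_mx 0 ord_max.
have pl : xlast p = 0 by rewrite /xlast coord_addZdelta eqxx mul1r -/(xlast x0) addrN.
have x0p : sqn (x0 - p) = xlast x0 ^+ 2.
  by rewrite /p opprD addNKr -scaleNr opprK sqn_Zdelta.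
have psq : sqn p <= 1 / 4.
  rewrite /p sqn_addZdelta -/(xlast x0).
  by have := sqr_ge0 (xlast x0); lra.
have B1x0 : eball 1 x0 by rewrite eball_sqn// expr1n; lra.
have Px0 : posset (eball 1 `\` closure (eball r1)) u x0 by [].
have cl x : closure (posset (eball 1 `\` closure (eball r1)) u) x -> - eta <= xlast x.
  by apply: closure_posset_xlast => {}x [Bx _]; exact: ux.
have KB x : slab_cylinder p x -> eball 1 x.
  move=> /slab_cylinder_sqn h; rewrite eball_sqn// expr1n.
  by apply: le_lt_trans (sqn_le_split2 x p) _; lra.
have := @slope_ge_comparison R n.+1 l (l / 3) (delta / 2) (- 4) (- (4 + 4 * d)) p
  (eball 1 `\` closure (eball r1)) (slab_cylinder p) u.
set phi := qtest _ _ _ _ _.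
have phiE x : phi x = l / 3 * (xlast x + delta / 2 + 4 * (sqn (x - p) - xlast x ^+ 2)
    - 4 * (d * xlast x ^+ 2)) by rewrite /phi /qtest; ring.
have l30 : l / 3 != 0 by rewrite gt_eqF// divr_gt0.
move=> /(_ l30 su (slab_cylinder_compact (p := p))) cmp.
have {}cmp : u x0 <= phi x0.
  apply: cmp; last exact: subset_closure.
  - by move=> x /KB Bx; exact: (admissible_continuous uL Bx).
  - move=> x Kx cx; have [x1 x2 xp] := Kx.
    have xeta := cl x cx.
    have Bx := KB x Kx.
    have xl2 : xlast x ^+ 2 <= eta * - xlast x by rewrite expr2; nra.
    have dxl2 : d * xlast x ^+ 2 <= l / 72 * - xlast x.
      have : d * xlast x ^+ 2 <= d * (eta * - xlast x) by rewrite ler_wpM2l//; lra.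
      by rewrite mulrA; have -> : d * eta = l / 72 by [lra|].
    have rad0 : 0 <= sqn (x - p) - xlast x ^+ 2 by rewrite subr_ge0 xlast_sqr_le.
    have phige : e + 4 / 3 * (l * (sqn (x - p) - xlast x ^+ 2)) - 19 / 54 * - xlast x <= phi x.
      have lx : l * - xlast x <= 1 * - xlast x by rewrite ler_wpM2r//; lra.
      have h : delta / 2 + 4 * (sqn (x - p) - xlast x ^+ 2) - 19 / 18 * - xlast x <=
          xlast x + delta / 2 + 4 * (sqn (x - p) - xlast x ^+ 2) - 4 * (d * xlast x ^+ 2).
        have : l / 72 * - xlast x <= 1 / 72 * - xlast x by rewrite ler_wpM2r//; lra.
        lra.
      have l3 : 0 <= l / 3 by lra.
      rewrite phiE; apply: le_trans (ler_wpM2l l3 h); rewrite eE; lra.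
    have lrad : 0 <= l * (sqn (x - p) - xlast x ^+ 2) by rewrite mulr_ge0// ltW.
    have [xr|xr] := pselect (closure (eball r1) x).
      left; have [h1 h2] := small x (closure_eball (ltW r10) xr).
      have dr : 0 <= d * r1 by apply: mulr_ge0; lra.
      by apply: le_trans phige; move: rD; rewrite DE; lra.
    have [xx0|xx0] := eqVneq (xlast x) 0.
      left; apply: le_trans phige; have := uup x; rewrite xx0 lexx add0r => h.
      suff : sqn x <= (3 / 4) ^+ 2 by move=> /h /(_ isT); move: lrad; rewrite xx0; lra.
      apply: le_trans (sqn_le_split x p) _; move: xp; rewrite xx0.
      by have -> : (3 / 4 : R) ^+ 2 = 9 / 16 by [field|]; lra.
    have [xr64|xr64] := eqVneq (sqn (x - p) - xlast x ^+ 2) (1 / 64).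
      left; apply: le_trans phige; rewrite xr64.
      have : u x <= eta.
        by apply: le_trans (ux x Bx) _; rewrite /pospart ge_max; lra.
      lra.
    right; split.
    - by split.
    - apply: slab_cylinder_nbhs; first lra.
      + by rewrite lt_neqAle xx0.
      + by rewrite lt_neqAle xr64.
    - by rewrite /phi laplacian_qtest; lra.
    rewrite enorm_lt ?ltW// /phi sqn_grad_qtest//.
    have dx : 0 <= d * - xlast x <= 1 / 72.
      apply/andP; split; first by rewrite mulr_ge0//; lra.
      have : d * - xlast x <= d * eta by rewrite ler_wpM2l//; lra.
      lra.
    have -> : 1 + 2 * (- (4 + 4 * d) - - 4) * xlast x = 1 + 8 * (d * - xlast x) by ring.
    have t1 : (1 + 8 * (d * - xlast x)) ^+ 2 <= (10 / 9) ^+ 2.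
      by rewrite ler_pXn2r// ?nnegrE; lra.
    have l20 : 0 < l ^+ 2 by rewrite exprn_gt0.
    have -> : (l / 3) ^+ 2 = l ^+ 2 * (1 / 9) by field.
    rewrite -mulrA -[ltRHS]mulr1 ltr_pM2l//.
    have e1 : (10 / 9 : R) ^+ 2 = 100 / 81 by field.
    have e2 : 4 * (- 4 : R) ^+ 2 = 64 by ring.
    by rewrite e2; move: t1; rewrite e1; lra.
  - split; rewrite ?x0p ?subrr; [|exact: ltW|lra].
    have := cl x0 (subset_closure Px0); lra.
have cle : l / 3 * (xlast x0 + delta / 2) <= pospart (xlast x0 + delta).
  have [h|h] := lerP (xlast x0 + delta / 2) 0.
    by apply: le_trans p2; rewrite mulr_ge0_le0//; lra.
  apply: le_trans p1; apply: (@le_trans _ _ (1 * (xlast x0 + delta / 2))).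
    by rewrite ler_pM2r//; lra.
  lra.
apply: le_trans cle; apply: le_trans cmp _; rewrite phiE x0p subrr mulr0 addr0.
have dx0 : 0 <= 4 * (d * xlast x0 ^+ 2).
  by apply: mulr_ge0 => //; apply: mulr_ge0; [lra|exact: sqr_ge0].
by rewrite ler_pM2l ?divr_gt0//; lra.
Qed.

End below_half_space.

Unset Implicit Arguments.
Set Strict Implicit.

(* The dimension is d = n.+2, i.e. an arbitrary d >= 2. *)
Theorem theorem3p1 (R : realType) (n : nat) :
  exists eta0 : R -> R,
    (forall l : R, 0 < l <= 1 -> 0 < eta0 l <= 4^-1) /\
    forall L : R, 1 <= L ->
      (forall delta l : R, 0 < delta -> 0 < l <= 1 ->
        exists r0 : R, 0 < r0 /\
        forall u : 'rV[R]_n.+2 -> R, admissible L u ->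
          (forall x, eball 1 x ->
             pospart (xlast x) <= u x <= pospart (xlast x + eta0 l)) ->
          slope_ge l (eball 1 `\` closure (eball r0)) u ->
          slope_le 1 (eball 1 `\` closure (eball r0)) u ->
          forall x, eball (2^-1) x -> u x <= pospart (xlast x + delta)) /\
      (forall delta l : R, 0 < delta -> 0 < l < 1 ->
        exists r0 : R, 0 < r0 /\
        forall u : 'rV[R]_n.+2 -> R, admissible L u ->
          (forall x, eball 1 x -> u x <= pospart (xlast x)) ->
          slope_ge l (eball 1) u ->
          slope_ge 1 (eball 1 `\` closure (eball r0)) u ->
          forall x, eball (2^-1) x -> pospart (xlast x - delta) <= u x).
Proof.
exists (fun l => l / (72 * n.+2%:R)); split.
  move=> l /andP[l0 l1]; have d2 : 2 <= n.+2%:R :> R by rewrite ler_nat.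
  have d0 : 0 < 72 * n.+2%:R :> R by lra.
  by rewrite divr_gt0//= ler_pdivrMr//; lra.
have B12 (x : 'rV[R]_n.+2) : eball 2^-1 x -> sqn x <= (3 / 4) ^+ 2 /\ eball 1 x.
  rewrite !eball_sqn ?invr_ge0// expr1n exprVn => h.
  have -> : (3 / 4 : R) ^+ 2 = 9 / 16 by field.
  by split; lra.
move=> L L1; split=> delta l delta0 => [l01|/andP[l0 l1]].
  have /andP[l0 l1] := l01.
  (* This error is the value (l/3)(delta/2) of the lower barrier at its axis on {x_d = 0}. *)
  have e0 : 0 < l * delta / 6 by rewrite divr_gt0// mulr_gt0.
  have [ra ra0 Ha] := upper_bound_on_half_space (n := n) L1 e0.
  have [rb rb0 Hb] := bound_below_half_space (n := n) L1 delta0 l01.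
  have r00 : 0 < Num.min ra rb by rewrite lt_min ra0.
  exists (Num.min ra rb); split => // u uL ux suge sule.
  have uxl x : eball 1 x -> pospart (xlast x) <= u x by move=> /ux/andP[].
  have uxr x : eball 1 x -> u x <= pospart (xlast x + l / (72 * n.+2%:R)) by move=> /ux/andP[].
  have ra' : 0 <= Num.min ra rb <= ra by rewrite ltW//= ge_min lexx.
  have rb' : 0 < Num.min ra rb <= rb by rewrite r00/= ge_min lexx orbT.
  have up := Ha _ u ra' uL uxl sule.
  move=> x Bx; have [x0|x0] := lerP 0 (xlast x); last exact: (Hb _ u rb' uL uxr suge up).
  apply: le_trans (up x (B12 x Bx).1 x0) _; rewrite /pospart le_max lerD2l.
  have : l * delta <= 1 * delta by rewrite ler_wpM2r// ltW.
  by move=> h; apply/orP; left; lra.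
have [r0 r00 H] := lower_bound_on_half_space (n := n) L1 delta0 l0.
exists r0; split => // u uL ux sl s1 x Bx; have [x34 B1x] := B12 x Bx.
have u0 := admissible_ge0 uL B1x.
rewrite /pospart ge_max u0 andbT; have [x0|x0] := lerP 0 (xlast x).
  exact: (H u uL ux sl s1).
(* Below {x_d = 0} the claimed lower bound is 0. *)
by apply: le_trans u0; lra.
Qed.
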